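(* Let $\lambda>0$. For every $\alpha\in\mathbb{R}$ and every $\beta$ with $0<\beta<1$, the boundary value problem $$f'''+(1+\lambda)ff''+2\lambda(1-f')f'=0\quad\text{on }[0,\infty),$$ $$f(0)=\alpha,\qquad f'(0)=\beta,\qquad f'(\infty)=1,$$ admits a unique convex solution.
   Context: Here $f:[0,\infty)\to\mathbb{R}$ is a (three times differentiable) real-valued function of $t\in[0,\infty)$, primes denote derivatives with respect to $t$, and $f'(\infty):=\lim_{t\to\infty}f'(t)$. A solution is called convex if $f''(t)>0$ for all $t\in[0,\infty)$ (strict inequality). *)

(* Defs.v *)
From Stdlib Require Import Reals.
From Coquelicot Require Import Coquelicot.
Open Scope R_scope.

Definition half_line (t : R) : Prop := 0 <= t.

(* A function [0,oo) -> R is represented by a function R -> R whose values at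
   negative arguments are irrelevant: [D_in] only takes difference quotients
   along [half_line], so the derivative at 0 is the right derivative. *)
Definition deriv_on_half_line (f f' : R -> R) : Prop :=
  forall t, half_line t -> D_in f f' half_line t.

Record bvp_solution (lambda alpha beta : R) (f f' f'' f''' : R -> R) : Prop := {
  bvp_deriv1 : deriv_on_half_line f f';
  bvp_deriv2 : deriv_on_half_line f' f'';
  bvp_deriv3 : deriv_on_half_line f'' f''';
  bvp_ode : forall t, half_line t ->
    f''' t + (1 + lambda) * f t * f'' t + 2 * lambda * (1 - f' t) * f' t = 0;
  bvp_init : f 0 = alpha;
  bvp_init' : f' 0 = beta;
  bvp_infty : is_lim f' p_infty 1
}.

(* The derivatives are determined by [f] on [half_line], so the existential
   quantifier only names them. *)
Definition convex_solution (lambda alpha beta : R) (f : R -> R) : Prop :=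
  exists f' f'' f''' : R -> R,
    bvp_solution lambda alpha beta f f' f'' f''' /\
    forall t, half_line t -> 0 < f'' t.

(* Main.v *)
Require Import Defs.
From Stdlib Require Import Reals Lra Lia ClassicalEpsilon.
From Coquelicot Require Import Coquelicot.
Open Scope R_scope.

(* Existence is by shooting on [c = f''(0)].  The values of [c] for which [f''] becomes negative
   while [f' < 1], and those for which [f'] exceeds 1 while [f'' > 0], form disjoint open sets; the
   first contains 0 and the second all large [c], so some [c > 0] lies in neither.  The corresponding
   orbit has [f'' > 0] and [f' < 1] forever, the corner [f' = 1], [f'' = 0] being excluded by
   backward uniqueness.  If [f'] stayed below [1 - eps], then [f''' <= - 2 lambda eps beta] once
   [f >= 0], which contradicts [f'' > 0].

   For uniqueness, compare two convex solutions at points where their velocities agree: regarding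
   position and acceleration as functions of [f'], a larger [f''(0)] stays larger by at least the
   initial gap, so [f''] is bounded below and [f'] cannot stay below 1; equal values of [f''(0)]
   give equal solutions because the differences solve a linear system. *)

(** * Volterra equations *)

(** The equation is quadratic, so a shot with arbitrary [f''(0)] need not a priori exist for all
    times. Clamping the velocity to [[0, 1]] gives an orbit on the whole half-line for every [c],
    Lipschitz in [c] on compact time intervals, and this dependence makes the two shooting sets
    open. Orbits that leave [[0, 1]] follow an artificial law afterwards, which is harmless: the
    critical orbit has velocity between [beta] and 1, where the clamp is the identity, so it solves
    the original equation.

    Comparing two solutions at equal times fails: u = f' - g' satisfies u'' = -(1 + lambda) f u' -
    (1 + lambda)(f - g) g'' + 2 lambda (f' + g' - 1) u, where f - g enters with the wrong sign and
    the last coefficient has no fixed sign. With y = f' as independent variable, x = f and z = f''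
    satisfy dx/dy = y/z and dz/dy = -(1 + lambda) x - 2 lambda (1 - y) y / z. A larger z makes x
    smaller, and both changes increase dz/dy, so an initial gap in z persists. *)

Lemma is_derive_RInt_from_0 (h : R -> R) (hc : forall x, continuous h x) (t : R) :
  is_derive (fun x => RInt h 0 x) t (h t).
Proof.
  apply (is_derive_RInt h (fun x => RInt h 0 x) 0 t); [|apply hc].
  apply filter_forall; intros x.
  apply (RInt_correct (V := R_CompleteNormedModule)),
    (ex_RInt_continuous (V := R_CompleteNormedModule)).
  intros; apply hc.
Qed.

Lemma continuous_Rabs_minus (p1 p2 : R -> R) (h1 : forall x, continuous p1 x)
    (h2 : forall x, continuous p2 x) (x : R) :
  continuous (fun r => Rabs (p1 r - p2 r)) x.
Proof.
  apply continuous_comp; [apply (continuous_minus p1 p2); auto | apply continuous_Rabs].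
Qed.

Definition dist_int (p1 p2 : R -> R) (t : R) : R := RInt (fun r => Rabs (p1 r - p2 r)) 0 t.

Lemma dist_int_ge0 (p1 p2 : R -> R) (h1 : forall x, continuous p1 x)
    (h2 : forall x, continuous p2 x) (t : R) : 0 <= t -> 0 <= dist_int p1 p2 t.
Proof.
  intros ht. apply RInt_ge_0; trivial.
  - apply (ex_RInt_continuous (V := R_CompleteNormedModule)); intros; apply continuous_Rabs_minus; auto.
  - intros; apply Rabs_pos.
Qed.

Lemma dist_int_le (p1 p2 : R -> R) (h1 : forall x, continuous p1 x)
    (h2 : forall x, continuous p2 x) (s t : R) :
  0 <= s -> s <= t -> dist_int p1 p2 s <= dist_int p1 p2 t.
Proof.
  intros hs hst. unfold dist_int.
  assert (hc := continuous_Rabs_minus p1 p2 h1 h2).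
  rewrite <- (RInt_Chasles (fun r => Rabs (p1 r - p2 r)) 0 s t);
    try (apply (ex_RInt_continuous (V := R_CompleteNormedModule)); intros; apply hc).
  assert (0 <= RInt (fun r => Rabs (p1 r - p2 r)) s t).
  { apply RInt_ge_0; trivial.
    - apply (ex_RInt_continuous (V := R_CompleteNormedModule)); intros; apply hc.
    - intros; apply Rabs_pos. }
  unfold plus; simpl; lra.
Qed.

Lemma dist_int_bound (p1 p2 h : R -> R) (h1 : forall x, continuous p1 x)
    (h2 : forall x, continuous p2 x) (hh : forall x, continuous h x) (t : R) :
  0 <= t -> (forall r, 0 <= r <= t -> Rabs (p1 r - p2 r) <= h r) ->
  dist_int p1 p2 t <= RInt h 0 t.
Proof.
  intros ht hle. apply RInt_le; trivial.
  - apply (ex_RInt_continuous (V := R_CompleteNormedModule)); intros; apply continuous_Rabs_minus; auto.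
  - apply (ex_RInt_continuous (V := R_CompleteNormedModule)); intros; apply hh.
  - intros x hx; apply hle; lra.
Qed.

Lemma RInt_lipschitz (p1 p2 k1 k2 : R -> R) (C t : R)
    (h1 : forall x, continuous p1 x) (h2 : forall x, continuous p2 x)
    (hk1 : forall x, continuous k1 x) (hk2 : forall x, continuous k2 x) :
  0 <= t -> (forall r, 0 <= r <= t -> Rabs (k1 r - k2 r) <= C * Rabs (p1 r - p2 r)) ->
  Rabs (RInt k1 0 t - RInt k2 0 t) <= C * dist_int p1 p2 t.
Proof.
  intros ht hle.
  assert (e1 : forall k : R -> R, (forall x, continuous k x) -> ex_RInt k 0 t)
    by (intros; apply (ex_RInt_continuous (V := R_CompleteNormedModule)); auto).
  replace (RInt k1 0 t - RInt k2 0 t) with (RInt (fun r => minus (k1 r) (k2 r)) 0 t)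
    by (apply (RInt_minus (V := R_CompleteNormedModule) k1 k2); auto).
  eapply Rle_trans.
  { apply abs_RInt_le; trivial.
    apply e1; intros; apply (continuous_minus k1 k2); auto. }
  unfold dist_int.
  replace (C * RInt (fun r => Rabs (p1 r - p2 r)) 0 t)
    with (RInt (fun r => scal C (Rabs (p1 r - p2 r))) 0 t)
    by (apply (RInt_scal (V := R_CompleteNormedModule) (fun r => Rabs (p1 r - p2 r)));
      apply e1, continuous_Rabs_minus; auto).
  apply RInt_le; trivial.
  - apply e1, (continuous_Rabs_minus k1 k2); auto.
  - apply e1; intros; apply (continuous_scal_r C (fun r => Rabs (p1 r - p2 r))).
    apply continuous_Rabs_minus; auto.
  - intros r hr; apply hle; lra.
Qed.

Lemma RInt_exp_le (K t : R) : 0 < K ->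
  K * RInt (fun r => exp (2 * K * r)) 0 t <= exp (2 * K * t) / 2.
Proof.
  intros hK.
  assert (H : is_RInt (fun r => exp (2 * K * r)) 0 t
     (minus (exp (2 * K * t) / (2 * K)) (exp (2 * K * 0) / (2 * K)))).
  { apply (is_RInt_derive (fun r => exp (2 * K * r) / (2 * K))).
    - intros x _. auto_derive; trivial. field. lra.
    - intros x _. apply (ex_derive_continuous (V := R_NormedModule)). auto_derive; trivial. }
  rewrite (is_RInt_unique _ _ _ _ H).
  rewrite Rmult_0_r, exp_0. unfold minus, plus, opp; simpl.
  apply Rle_trans with (exp (2 * K * t) / 2 - 1 / 2); [right; field; lra | lra].
Qed.

Lemma continuous_exp_linear (a x : R) : continuous (fun r => exp (a * r)) x.
Proof.
  apply (ex_derive_continuous (V := R_NormedModule)). auto_derive; trivial.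
Qed.

Lemma continuous_bounded (h : R -> R) (T : R) :
  0 <= T -> (forall x, 0 <= x <= T -> continuous h x) ->
  exists M, 0 <= M /\ forall t, 0 <= t <= T -> Rabs (h t) <= M.
Proof.
  intros hT hc.
  destruct (continuity_ab_maj (fun t => Rabs (h t)) 0 T hT) as [m [hm _]].
  - intros x hx. apply continuity_pt_filterlim.
    apply (continuous_comp h Rabs); [apply hc, hx | apply continuous_Rabs].
  - exists (Rabs (h m)); split; [apply Rabs_pos | auto].
Qed.

(** In the sup norm with weight exp(-2Kt), integrating and multiplying by [K] gains a factor 1/2,
    because K times the integral of exp(2Kr) over [0, t] is at most exp(2Kt) / 2. Both the Gronwall
    bound and the convergence of the Picard iterates come from this halving, on intervals of any
    length. *)
Lemma dist_int_exp (p1 p2 : R -> R) (M K T : R) (h1 : forall x, continuous p1 x)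
    (h2 : forall x, continuous p2 x) :
  0 < K -> 0 <= M ->
  (forall t, 0 <= t <= T -> Rabs (p1 t - p2 t) <= M * exp (2 * K * t)) ->
  forall t, 0 <= t <= T -> K * dist_int p1 p2 t <= M / 2 * exp (2 * K * t).
Proof.
  intros hK hM hle t ht.
  assert (hb : dist_int p1 p2 t <= RInt (fun r => scal M (exp (2 * K * r))) 0 t).
  { apply dist_int_bound; trivial; try lra.
    - intros x; apply (continuous_scal_r M (fun r => exp (2 * K * r))), continuous_exp_linear.
    - intros r hr; apply hle; lra. }
  rewrite (RInt_scal (V := R_CompleteNormedModule) (fun r => exp (2 * K * r))) in hb
    by (apply (ex_RInt_continuous (V := R_CompleteNormedModule)); intros; apply continuous_exp_linear).
  assert (he := RInt_exp_le K t hK).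
  unfold scal in hb; simpl in hb; unfold mult in hb; simpl in hb.
  apply Rle_trans with (K * (M * RInt (fun r => exp (2 * K * r)) 0 t)).
  - apply Rmult_le_compat_l; lra.
  - nra.
Qed.

(* Halving the constant in [M * exp (2 K t)] repeatedly avoids an integrating factor. *)
Lemma gronwall (p1 p2 : R -> R) (A K T : R) (h1 : forall x, continuous p1 x)
    (h2 : forall x, continuous p2 x) :
  0 < K -> 0 <= A ->
  (forall t, 0 <= t <= T -> Rabs (p1 t - p2 t) <= A + K * dist_int p1 p2 t) ->
  forall t, 0 <= t <= T -> Rabs (p1 t - p2 t) <= 2 * A * exp (2 * K * t).
Proof.
  intros hK hA hle t ht.
  assert (hexp : forall r, 0 <= r -> 1 <= exp (2 * K * r)).
  { intros r hr. rewrite <- exp_0. destruct (Req_dec r 0) as [->|]; [rewrite Rmult_0_r; lra|].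
    left; apply exp_increasing; nra. }
  destruct (continuous_bounded (fun r => p1 r - p2 r) T) as [M [hM hbM]].
  { lra. }
  { intros x _; apply (continuous_minus p1 p2); auto. }
  (* One application of the hypothesis turns a constant x into A + x / 2; starting from 2A + M, the
     excess over the fixed point 2A is halved each time. *)
  assert (hn : forall n r, 0 <= r <= T ->
    Rabs (p1 r - p2 r) <= (2 * A + M * (/ 2) ^ n) * exp (2 * K * r)).
  { induction n as [|n IH]; intros r hr.
    - specialize (hbM r hr); specialize (hexp r (proj1 hr)); simpl; nra.
    - assert (hpow : 0 <= (/ 2) ^ n) by (apply pow_le; lra).
      assert (hd : K * dist_int p1 p2 r <= (2 * A + M * (/ 2) ^ n) / 2 * exp (2 * K * r)).
      { apply (dist_int_exp p1 p2 _ K T); trivial; nra. }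
      specialize (hle r hr); specialize (hexp r (proj1 hr)). simpl. nra. }
  apply (is_lim_seq_le (fun _ => Rabs (p1 t - p2 t))
    (fun n => (2 * A + M * (/ 2) ^ n) * exp (2 * K * t))
    (Rabs (p1 t - p2 t)) (2 * A * exp (2 * K * t))).
  - intros n; apply hn, ht.
  - apply is_lim_seq_const.
  - replace (2 * A * exp (2 * K * t)) with ((2 * A + M * 0) * exp (2 * K * t)) by ring.
    apply (is_lim_seq_scal_r _ (exp (2 * K * t)) (2 * A + M * 0)).
    apply is_lim_seq_plus'; [apply is_lim_seq_const|].
    apply (is_lim_seq_scal_l _ M 0), is_lim_seq_geom. rewrite Rabs_pos_eq; lra.
Qed.

(** The Lipschitz condition is causal: the output at [t] is controlled by the integrated discrepancy
    of the inputs up to [t]. [K] may depend on the horizon [T], since the velocity operator below is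
    not uniformly Lipschitz in time. *)
Definition volterra (Phi : (R -> R) -> R -> R) : Prop :=
  (forall p, (forall x, continuous p x) -> forall x, continuous (Phi p) x) /\
  (forall T, 0 <= T -> exists K, 0 < K /\
     forall p1 p2, (forall x, continuous p1 x) -> (forall x, continuous p2 x) ->
     forall t, 0 <= t <= T -> Rabs (Phi p1 t - Phi p2 t) <= K * dist_int p1 p2 t).

(* Precomposing with [Rmax 0] keeps the iterates continuous on the whole line while only the
   values of the operator on the half-line matter. *)
Fixpoint picard (Phi : (R -> R) -> R -> R) (n : nat) : R -> R :=
  match n with
  | O => fun _ => 0
  | S n => fun t => Phi (picard Phi n) (Rmax 0 t)
  end.

Lemma continuous_Rmax0 (x : R) : continuous (fun t => Rmax 0 t) x.
Proof.
  apply (continuous_ext (fun t => (t + Rabs t) / 2)).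
  - intros t. unfold Rmax, Rabs; destruct (Rle_dec 0 t), (Rcase_abs t); lra.
  - apply (continuous_scal_l (fun t => t + Rabs t) (/ 2)), (continuous_plus (fun t => t) Rabs).
    apply continuous_id. apply continuous_Rabs.
Qed.

Lemma continuous_picard (Phi : (R -> R) -> R -> R) (hPhi : volterra Phi) (n : nat) :
  forall x, continuous (picard Phi n) x.
Proof.
  induction n as [|n IH]; intros x; simpl.
  - apply continuous_const.
  - apply (continuous_comp (fun t => Rmax 0 t) (Phi (picard Phi n))).
    apply continuous_Rmax0. apply (proj1 hPhi), IH.
Qed.

(** Consecutive iterates contract by 1/2 in the norm weighted by exp(-2Kt); the weight is finally
    absorbed into [C] through its value at [T]. *)
Lemma picard_step (Phi : (R -> R) -> R -> R) (hPhi : volterra Phi) (T : R) :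
  0 <= T -> exists C, 0 <= C /\ forall n t, 0 <= t <= T ->
    Rabs (picard Phi (S n) t - picard Phi n t) <= C * (/ 2) ^ n.
Proof.
  intros hT. destruct (proj2 hPhi T hT) as [K [hK hlip]].
  assert (hc := continuous_picard Phi hPhi).
  destruct (continuous_bounded (fun t => picard Phi 1 t - picard Phi 0 t) T) as [M [hM hbM]];
    trivial.
  { intros x _; apply (continuous_minus (picard Phi 1) (picard Phi 0)); apply hc. }
  assert (hn : forall n t, 0 <= t <= T ->
    Rabs (picard Phi (S n) t - picard Phi n t) <= M * (/ 2) ^ n * exp (2 * K * t)).
  { induction n as [|n IH]; intros t ht.
    - specialize (hbM t ht).
      assert (1 <= exp (2 * K * t)).
      { assert (h := exp_ineq1_le (2 * K * t)). nra. }
      replace (M * (/ 2) ^ 0) with M by (simpl; ring).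
      apply Rle_trans with M; [trivial | nra].
    - change (Rabs (Phi (picard Phi (S n)) (Rmax 0 t) - Phi (picard Phi n) (Rmax 0 t))
        <= M * (/ 2) ^ S n * exp (2 * K * t)).
      rewrite Rmax_right by lra.
      eapply Rle_trans; [apply hlip; auto|].
      replace (M * (/ 2) ^ S n) with (M * (/ 2) ^ n / 2) by (simpl; field).
      apply (dist_int_exp _ _ (M * (/ 2) ^ n) K T); auto.
      apply Rmult_le_pos; [trivial | apply pow_le; lra]. }
  exists (M * exp (2 * K * T)); split.
  - apply Rmult_le_pos; [trivial | left; apply exp_pos].
  - intros n t ht. eapply Rle_trans; [apply hn, ht|].
    assert (exp (2 * K * t) <= exp (2 * K * T)).
    { destruct (Req_dec t T) as [->|]; [lra | left; apply exp_increasing; nra]. }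
    assert (0 <= (/ 2) ^ n) by (apply pow_le; lra).
    replace (M * exp (2 * K * T) * (/ 2) ^ n) with (M * (/ 2) ^ n * exp (2 * K * T)) by ring.
    apply Rmult_le_compat_l; [apply Rmult_le_pos|]; trivial.
Qed.

Lemma picard_limit (Phi : (R -> R) -> R -> R) (hPhi : volterra Phi) (T : R) :
  0 <= T -> exists C, 0 <= C /\ forall n t, 0 <= t <= T ->
    Rabs (real (Lim_seq (fun n => picard Phi n t)) - picard Phi n t) <= C * (/ 2) ^ n.
Proof.
  intros hT. destruct (picard_step Phi hPhi T hT) as [C [hC hstep]].
  (* The factor 1 - 2^(-k) is the exact geometric partial sum, kept so that the induction on [k]
     closes. *)
  assert (hk : forall n k t, 0 <= t <= T ->
    Rabs (picard Phi (n + k) t - picard Phi n t) <= 2 * C * (/ 2) ^ n * (1 - (/ 2) ^ k)).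
  { intros n k t ht. induction k as [|k IH].
    - rewrite Nat.add_0_r, Rminus_diag, Rabs_R0. simpl. lra.
    - rewrite Nat.add_succ_r.
      specialize (hstep (n + k)%nat t ht).
      replace (picard Phi (S (n + k)) t - picard Phi n t) with
        ((picard Phi (S (n + k)) t - picard Phi (n + k) t) +
         (picard Phi (n + k) t - picard Phi n t)) by ring.
      eapply Rle_trans; [apply Rabs_triang|].
      rewrite pow_add in hstep. simpl pow. nra. }
  assert (hk' : forall n k t, 0 <= t <= T ->
    Rabs (picard Phi (n + k) t - picard Phi n t) <= 2 * C * (/ 2) ^ n).
  { intros n k t ht. eapply Rle_trans; [apply hk, ht|].
    assert (0 <= (/ 2) ^ k) by (apply pow_le; lra).
    assert (0 <= C * (/ 2) ^ n) by (apply Rmult_le_pos; [trivial | apply pow_le; lra]).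
    nra. }
  exists (2 * C); split; [lra|]. intros n t ht.
  assert (hcau : ex_lim_seq_cauchy (fun n => picard Phi n t)).
  { intros eps.
    assert (hg : is_lim_seq (fun n => 4 * C * (/ 2) ^ n) 0).
    { replace (Finite 0) with (Rbar_mult (4 * C) 0) by (simpl; f_equal; ring).
      apply is_lim_seq_scal_l, is_lim_seq_geom. rewrite Rabs_pos_eq; lra. }
    apply is_lim_seq_spec in hg. destruct (hg eps) as [N hN].
    exists N. intros i j hi hj.
    assert (hi' := hk' N (i - N)%nat t ht). assert (hj' := hk' N (j - N)%nat t ht).
    replace (N + (i - N))%nat with i in hi' by lia.
    replace (N + (j - N))%nat with j in hj' by lia.
    specialize (hN N (Nat.le_refl N)). rewrite Rminus_0_r in hN.
    apply Rabs_def2 in hN.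
    replace (picard Phi i t - picard Phi j t) with
      ((picard Phi i t - picard Phi N t) - (picard Phi j t - picard Phi N t)) by ring.
    unfold Rminus at 1. eapply Rle_lt_trans; [apply Rabs_triang|]. rewrite Rabs_Ropp. lra. }
  apply ex_lim_seq_cauchy_corr in hcau.
  apply Lim_seq_correct' in hcau.
  apply (is_lim_seq_incr_n _ n) in hcau.
  apply (is_lim_seq_le (fun k => Rabs (picard Phi (k + n) t - picard Phi n t))
    (fun _ => 2 * C * (/ 2) ^ n)
    (Rabs (real (Lim_seq (fun n => picard Phi n t)) - picard Phi n t)) (2 * C * (/ 2) ^ n)).
  - intros k. rewrite Nat.add_comm. apply hk', ht.
  - apply (is_lim_seq_abs _ (Finite _)), is_lim_seq_minus'; [exact hcau | apply is_lim_seq_const].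
  - apply is_lim_seq_const.
Qed.

(** Geometric convergence, uniform on bounded times, makes the limit continuous. Its defect
    [p - Phi p] is the distance to iterate n + 1 plus the image under [Phi] of the distance to
    iterate n, hence of order 2^(-n) for every n. *)
Lemma picard_solution (Phi : (R -> R) -> R -> R) (hPhi : volterra Phi) :
  exists p, (forall x, continuous p x) /\ forall t, 0 <= t -> p t = Phi p t.
Proof.
  (* With [Rmax 0] the limit and the iterates are constant on negative times, so the estimate on
     [0, T] is valid for all [t <= T], as the uniform convergence on a ball around any [x]
     requires. *)
  set (p := fun t => real (Lim_seq (fun n => picard Phi n (Rmax 0 t)))).
  assert (hrm : forall n t, picard Phi n (Rmax 0 t) = picard Phi n t).
  { intros [|n] t; simpl; trivial. f_equal. apply Rmax_right, Rmax_l. }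
  assert (hlim : forall T, 0 <= T -> exists C, 0 <= C /\ forall n t, t <= T ->
    Rabs (p t - picard Phi n t) <= C * (/ 2) ^ n).
  { intros T hT. destruct (picard_limit Phi hPhi T hT) as [C [hC hb]].
    exists C; split; trivial. intros n t ht. rewrite <- (hrm n t).
    apply hb. split; [apply Rmax_l | apply Rmax_lub; lra]. }
  assert (hgeom : forall C, is_lim_seq (fun n => C * (/ 2) ^ n) 0).
  { intros C. replace (Finite 0) with (Rbar_mult C 0) by (simpl; f_equal; ring).
    apply is_lim_seq_scal_l, is_lim_seq_geom. rewrite Rabs_pos_eq; lra. }
  assert (hpc : forall x, continuous p x).
  { intros x. apply continuity_pt_filterlim.
    apply (CVU_continuity (picard Phi) p x (mkposreal 1 Rlt_0_1)).
    - intros eps heps.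
      destruct (hlim (Rabs x + 1)) as [C [hC hb]]; [assert (h := Rabs_pos x); lra|].
      specialize (hgeom C). apply is_lim_seq_spec in hgeom.
      destruct (hgeom (mkposreal eps heps)) as [N hN]. exists N. intros n y hn hy.
      eapply Rle_lt_trans; [apply hb|].
      + unfold Boule in hy; simpl in hy. apply Rabs_def2 in hy.
        assert (h := Rle_abs x). lra.
      + specialize (hN n hn). rewrite Rminus_0_r in hN. apply Rabs_def2 in hN.
        simpl in hN. lra.
    - intros n y _. apply continuity_pt_filterlim, continuous_picard, hPhi.
    - unfold Boule; simpl. rewrite Rminus_diag, Rabs_R0. lra. }
  exists p; split; trivial. intros t ht.
  destruct (hlim t ht) as [C [hC hb]].
  destruct (proj2 hPhi t ht) as [K [hK hlip]].
  assert (hc := continuous_picard Phi hPhi).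
  assert (hn : forall n, Rabs (p t - Phi p t) <= (C / 2 + K * C * t) * (/ 2) ^ n).
  { intros n.
    replace (p t - Phi p t) with
      ((p t - picard Phi (S n) t) + (Phi (picard Phi n) t - Phi p t))
      by (simpl; rewrite Rmax_right by trivial; ring).
    eapply Rle_trans; [apply Rabs_triang|].
    assert (h1 := hb (S n) t (Rle_refl t)).
    assert (h2 := hlip (picard Phi n) p (hc n) hpc t (conj ht (Rle_refl t))).
    assert (h3 : dist_int (picard Phi n) p t <= RInt (fun _ => C * (/ 2) ^ n) 0 t).
    { apply dist_int_bound; auto.
      - intros; apply continuous_const.
      - intros r hr. rewrite Rabs_minus_sym. apply hb; lra. }
    rewrite RInt_const in h3. unfold scal in h3; simpl in h3; unfold mult in h3; simpl in h3.
    simpl in h1. simpl pow in h1.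
    apply Rmult_le_compat_l with (r := K) in h3; [|lra].
    simpl picard. lra. }
  apply Rminus_diag_uniq.
  assert (habs : Rabs (p t - Phi p t) <= 0).
  { apply (is_lim_seq_le (fun _ => Rabs (p t - Phi p t)) (fun n => (C / 2 + K * C * t) * (/ 2) ^ n)
      (Rabs (p t - Phi p t)) 0); trivial. apply is_lim_seq_const. }
  assert (h := Rabs_pos (p t - Phi p t)).
  destruct (Req_dec (p t - Phi p t) 0); trivial.
  apply Rabs_pos_lt in H. lra.
Qed.

(** * The integral equation for the velocity *)

Definition clamp (x : R) : R := Rmax 0 (Rmin 1 x).

Lemma clamp_bounds (x : R) : 0 <= clamp x <= 1.
Proof.
  unfold clamp, Rmax, Rmin. destruct (Rle_dec 1 x), (Rle_dec 0 _); lra.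
Qed.

Lemma clamp_id (x : R) : 0 <= x <= 1 -> clamp x = x.
Proof.
  intros hx. unfold clamp. rewrite Rmin_right, Rmax_right; lra.
Qed.

Lemma clamp_lipschitz (x y : R) : Rabs (clamp x - clamp y) <= Rabs (x - y).
Proof.
  unfold clamp, Rmax, Rmin.
  destruct (Rle_dec 1 x), (Rle_dec 1 y); repeat destruct (Rle_dec 0 _);
    unfold Rabs; repeat destruct (Rcase_abs _); lra.
Qed.

Lemma continuous_lipschitz (h : R -> R) (C : R) :
  (forall x y, Rabs (h x - h y) <= C * Rabs (x - y)) -> forall x, continuous h x.
Proof.
  intros hl x. apply filterlim_locally. intros eps.
  assert (hC : 0 < Rabs C + 1) by (assert (h1 := Rabs_pos C); lra).
  assert (he : 0 < eps / (Rabs C + 1)) by (apply Rdiv_lt_0_compat; [apply cond_pos | lra]).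
  exists (mkposreal _ he). intros y hy.
  change (Rabs (y - x) < eps / (Rabs C + 1)) in hy.
  change (Rabs (h y - h x) < eps).
  eapply Rle_lt_trans; [apply hl|].
  apply Rle_lt_trans with ((Rabs C + 1) * Rabs (y - x)).
  - apply Rmult_le_compat_r; [apply Rabs_pos | assert (h1 := Rle_abs C); lra].
  - apply Rmult_lt_compat_l with (r := Rabs C + 1) in hy; trivial.
    replace ((Rabs C + 1) * (eps / (Rabs C + 1))) with (pos eps) in hy by (field; lra). lra.
Qed.

Definition source (l x : R) : R := (1 + l) * (clamp x * clamp x) - 2 * l * (1 - clamp x) * clamp x.

(** In the clamped value u the source is (1 + 3l) u^2 - 2l u. Its divided difference (1 + 3l)(u + v)
    - 2l lies between -2l and 2 + 4l. *)
Lemma source_lipschitz (l x y : R) : 0 < l ->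
  Rabs (source l x - source l y) <= (2 + 4 * l) * Rabs (x - y).
Proof.
  intros hl. assert (hx := clamp_bounds x). assert (hy := clamp_bounds y).
  assert (hc := clamp_lipschitz x y). unfold source.
  replace ((1 + l) * (clamp x * clamp x) - 2 * l * (1 - clamp x) * clamp x -
    ((1 + l) * (clamp y * clamp y) - 2 * l * (1 - clamp y) * clamp y))
    with (((1 + 3 * l) * (clamp x + clamp y) - 2 * l) * (clamp x - clamp y)) by ring.
  rewrite Rabs_mult. apply Rmult_le_compat; try apply Rabs_pos; trivial.
  assert (0 <= l * clamp x <= l) by (split; nra).
  assert (0 <= l * clamp y <= l) by (split; nra).
  apply Rabs_le. lra.
Qed.

Lemma source_bound (l x : R) : 0 < l -> Rabs (source l x) <= 1 + 3 * l.
Proof.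
  intros hl. assert (hx := clamp_bounds x). unfold source.
  assert (0 <= clamp x * clamp x <= 1) by (split; nra).
  assert (0 <= l * clamp x <= l) by (split; nra).
  assert (0 <= l * (clamp x * clamp x) <= l) by (split; nra).
  apply Rabs_le. lra.
Qed.

Lemma continuous_clamp (p : R -> R) (hp : forall x, continuous p x) :
  forall x, continuous (fun r => clamp (p r)) x.
Proof.
  intros x. apply (continuous_comp p clamp); [apply hp|].
  apply (continuous_lipschitz clamp 1). intros; rewrite Rmult_1_l; apply clamp_lipschitz.
Qed.

Lemma continuous_source (l : R) (p : R -> R) (hl : 0 < l) (hp : forall x, continuous p x) :
  forall x, continuous (fun r => source l (p r)) x.
Proof.
  intros x. apply (continuous_comp p (source l)); [apply hp|].
  apply (continuous_lipschitz (source l) (2 + 4 * l)).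
  intros; apply source_lipschitz; trivial.
Qed.

(* Since [(f'' + (1 + l) f f')' = (1 + l) f'^2 - 2 l (1 - f') f'] and [f f' = (f^2 / 2)'], the
   equation becomes a fixed-point equation for [p = f'] alone; [f] is recovered by [pos_of] and
   [f'' + (1 + l) f f'] by [mom_of].  Clamping [f'] to [[0, 1]] makes it Lipschitz. *)
Definition pos_of (a : R) (p : R -> R) (t : R) : R := a + RInt (fun r => clamp (p r)) 0 t.

Definition mom_of (l a b c : R) (p : R -> R) (t : R) : R :=
  c + (1 + l) * a * b + RInt (fun r => source l (p r)) 0 t.

Definition vel_of (l a b c : R) (p : R -> R) (t : R) : R :=
  b + RInt (mom_of l a b c p) 0 t - (1 + l) / 2 * (pos_of a p t * pos_of a p t - a * a).

(** The clamp is present because the derivative of [pos_of] is the clamped velocity. *)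
Definition acc_of (l a b c : R) (p : R -> R) (t : R) : R :=
  mom_of l a b c p t - (1 + l) * pos_of a p t * clamp (p t).

Lemma is_derive_minus_square (I F : R -> R) (b k m t dI dF : R) :
  is_derive I t dI -> is_derive F t dF ->
  is_derive (fun x => b + I x - k * (F x * F x - m)) t (dI - k * (2 * F t * dF)).
Proof.
  intros h1 h2.
  assert (e1 : Derive (fun x => I x) t = dI) by (apply is_derive_unique, h1).
  assert (e2 : Derive (fun x => F x) t = dF) by (apply is_derive_unique, h2).
  auto_derive.
  - repeat split; eexists; eauto.
  - rewrite e1, e2. ring.
Qed.

(** * Orbits of the clamped equation: regularity, existence, dependence on the initial
    acceleration *)

Section Orbit.

Variables (l a b : R).
Hypothesis hl : 0 < l.

Section One.
Variables (c : R) (p : R -> R).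
Hypothesis hp : forall x, continuous p x.

Lemma is_derive_pos_of (t : R) : is_derive (pos_of a p) t (clamp (p t)).
Proof.
  apply (is_derive_ext (fun x => plus a (RInt (fun r => clamp (p r)) 0 x))); [trivial|].
  replace (clamp (p t)) with (plus 0 (clamp (p t))) by (unfold plus; simpl; ring).
  apply (is_derive_plus (V := R_NormedModule)); [apply (is_derive_const (V := R_NormedModule)) |].
  apply (is_derive_RInt_from_0 (fun r => clamp (p r))), continuous_clamp, hp.
Qed.

Lemma is_derive_mom_of (t : R) : is_derive (mom_of l a b c p) t (source l (p t)).
Proof.
  apply (is_derive_ext (fun x => plus (c + (1 + l) * a * b) (RInt (fun r => source l (p r)) 0 x)));
    [trivial|].
  replace (source l (p t)) with (plus 0 (source l (p t))) by (unfold plus; simpl; ring).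
  apply (is_derive_plus (V := R_NormedModule)); [apply (is_derive_const (V := R_NormedModule)) |].
  apply (is_derive_RInt_from_0 (fun r => source l (p r))), continuous_source; trivial.
Qed.

Lemma continuous_mom_of (t : R) : continuous (mom_of l a b c p) t.
Proof.
  apply (ex_derive_continuous (V := R_NormedModule)). eexists; apply is_derive_mom_of.
Qed.

Lemma continuous_pos_of (t : R) : continuous (pos_of a p) t.
Proof.
  apply (ex_derive_continuous (V := R_NormedModule)). eexists; apply is_derive_pos_of.
Qed.

Lemma is_derive_vel_of (t : R) : is_derive (vel_of l a b c p) t (acc_of l a b c p t).
Proof.
  assert (h1 := is_derive_RInt_from_0 _ continuous_mom_of t).
  assert (h2 := is_derive_pos_of t).
  replace (acc_of l a b c p t) with
    (mom_of l a b c p t - (1 + l) / 2 * (2 * pos_of a p t * clamp (p t)))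
    by (unfold acc_of; field).
  apply (is_derive_minus_square (fun y => RInt (mom_of l a b c p) 0 y)); trivial.
Qed.

Lemma pos_of_bound (t : R) : 0 <= t -> Rabs (pos_of a p t) <= Rabs a + t.
Proof.
  intros ht. unfold pos_of. eapply Rle_trans; [apply Rabs_triang|].
  apply Rplus_le_compat_l.
  replace t with ((t - 0) * 1) at 2 by ring.
  apply abs_RInt_le_const; trivial.
  - apply (ex_RInt_continuous (V := R_CompleteNormedModule)); intros; apply continuous_clamp, hp.
  - intros r _. assert (h := clamp_bounds (p r)). apply Rabs_le; lra.
Qed.

Lemma mom_of_bound (t : R) : 0 <= t ->
  Rabs (mom_of l a b c p t - (c + (1 + l) * a * b)) <= (1 + 3 * l) * t.
Proof.
  intros ht. unfold mom_of.
  replace (c + (1 + l) * a * b + RInt (fun r => source l (p r)) 0 t - (c + (1 + l) * a * b))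
    with (RInt (fun r => source l (p r)) 0 t) by (symmetry; apply Rplus_minus_l).
  replace ((1 + 3 * l) * t) with ((t - 0) * (1 + 3 * l)) by ring.
  apply abs_RInt_le_const; trivial.
  - apply (ex_RInt_continuous (V := R_CompleteNormedModule)); intros; apply continuous_source; trivial.
  - intros r _. apply source_bound; trivial.
Qed.

Lemma pos_of_0 : pos_of a p 0 = a.
Proof. unfold pos_of. rewrite RInt_point. apply Rplus_0_r. Qed.

Lemma mom_of_0 : mom_of l a b c p 0 = c + (1 + l) * a * b.
Proof. unfold mom_of. rewrite RInt_point. apply Rplus_0_r. Qed.

Lemma vel_of_0 : vel_of l a b c p 0 = b.
Proof.
  unfold vel_of. rewrite RInt_point, pos_of_0, Rminus_diag, Rmult_0_r, Rminus_0_r.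
  apply Rplus_0_r.
Qed.

Lemma continuous_vel_of (t : R) : continuous (vel_of l a b c p) t.
Proof.
  apply (ex_derive_continuous (V := R_NormedModule)). eexists; apply is_derive_vel_of.
Qed.

Lemma continuous_acc_of (t : R) : continuous (acc_of l a b c p) t.
Proof.
  apply (continuous_minus (mom_of l a b c p) (fun t => (1 + l) * pos_of a p t * clamp (p t))).
  - apply continuous_mom_of.
  - apply (continuous_mult (fun t => (1 + l) * pos_of a p t) (fun t => clamp (p t))).
    + apply (continuous_scal_r (1 + l) (pos_of a p)), continuous_pos_of.
    + apply continuous_clamp, hp.
Qed.

End One.

Lemma pos_of_lipschitz (p1 p2 : R -> R) (h1 : forall x, continuous p1 x)
    (h2 : forall x, continuous p2 x) (t : R) : 0 <= t ->
  Rabs (pos_of a p1 t - pos_of a p2 t) <= dist_int p1 p2 t.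
Proof.
  intros ht. unfold pos_of.
  replace (a + RInt (fun r => clamp (p1 r)) 0 t - (a + RInt (fun r => clamp (p2 r)) 0 t))
    with (RInt (fun r => clamp (p1 r)) 0 t - RInt (fun r => clamp (p2 r)) 0 t)
    by (symmetry; apply (Rminus_plus_l_l a)).
  rewrite <- (Rmult_1_l (dist_int p1 p2 t)).
  apply RInt_lipschitz; trivial; try (apply continuous_clamp; trivial).
  intros r _. rewrite Rmult_1_l. apply clamp_lipschitz.
Qed.

Lemma mom_of_lipschitz (c1 c2 : R) (p1 p2 : R -> R) (h1 : forall x, continuous p1 x)
    (h2 : forall x, continuous p2 x) (t : R) : 0 <= t ->
  Rabs (mom_of l a b c1 p1 t - mom_of l a b c2 p2 t) <=
    Rabs (c1 - c2) + (2 + 4 * l) * dist_int p1 p2 t.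
Proof.
  intros ht. unfold mom_of.
  replace (c1 + (1 + l) * a * b + RInt (fun r => source l (p1 r)) 0 t -
    (c2 + (1 + l) * a * b + RInt (fun r => source l (p2 r)) 0 t))
    with ((c1 - c2) + (RInt (fun r => source l (p1 r)) 0 t - RInt (fun r => source l (p2 r)) 0 t))
    by (generalize (RInt (fun r => source l (p1 r)) 0 t) (RInt (fun r => source l (p2 r)) 0 t);
        intros u v; simpl in u, v; ring).
  eapply Rle_trans; [apply Rabs_triang|]. apply Rplus_le_compat_l.
  apply RInt_lipschitz; trivial; try (apply continuous_source; trivial).
  intros r _. apply source_lipschitz; trivial.
Qed.

(** The square of the position is the only unbounded nonlinearity. It is handled by f1^2 - f2^2 =
    (f1 + f2)(f1 - f2), where the clamp keeps each position below |a| + T in absolute value. The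
    final 1 in [K] ensures positivity. Allowing two initial accelerations makes the same estimate
    serve existence and dependence on [c]. *)
Lemma vel_of_lipschitz (T : R) : 0 <= T -> exists K, 0 < K /\
  forall (c1 c2 : R) (p1 p2 : R -> R), (forall x, continuous p1 x) -> (forall x, continuous p2 x) ->
  forall t, 0 <= t <= T ->
    Rabs (vel_of l a b c1 p1 t - vel_of l a b c2 p2 t) <=
      T * Rabs (c1 - c2) + K * dist_int p1 p2 t.
Proof.
  intros hT. assert (ha := Rabs_pos a).
  exists (T * (2 + 4 * l) + (1 + l) * (Rabs a + T) + 1); split; [nra|].
  intros c1 c2 p1 p2 h1 h2 t ht.
  assert (hd := dist_int_ge0 p1 p2 h1 h2 t (proj1 ht)).
  assert (hm : Rabs (RInt (mom_of l a b c1 p1) 0 t - RInt (mom_of l a b c2 p2) 0 t) <=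
    (t - 0) * (Rabs (c1 - c2) + (2 + 4 * l) * dist_int p1 p2 t)).
  { assert (e1 : forall c p, (forall x, continuous p x) -> ex_RInt (mom_of l a b c p) 0 t).
    { intros c p hp. apply (ex_RInt_continuous (V := R_CompleteNormedModule)).
      intros; apply continuous_mom_of, hp. }
    replace (RInt (mom_of l a b c1 p1) 0 t - RInt (mom_of l a b c2 p2) 0 t)
      with (RInt (fun r => minus (mom_of l a b c1 p1 r) (mom_of l a b c2 p2 r)) 0 t)
      by (apply (RInt_minus (V := R_CompleteNormedModule)); auto).
    apply abs_RInt_le_const; [lra | |].
    - apply (ex_RInt_minus (V := R_NormedModule)); auto.
    - intros r hr. eapply Rle_trans; [apply mom_of_lipschitz; trivial; lra|].
      apply Rplus_le_compat_l, Rmult_le_compat_l; [lra|].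
      apply dist_int_le; trivial; lra. }
  assert (hf := pos_of_lipschitz p1 p2 h1 h2 t (proj1 ht)).
  assert (hs : Rabs (pos_of a p1 t + pos_of a p2 t) <= 2 * (Rabs a + T)).
  { eapply Rle_trans; [apply Rabs_triang|].
    assert (h3 := pos_of_bound p1 h1 t (proj1 ht)).
    assert (h4 := pos_of_bound p2 h2 t (proj1 ht)). lra. }
  unfold vel_of.
  set (D := dist_int p1 p2 t) in *. set (C := Rabs (c1 - c2)) in *.
  set (f1 := pos_of a p1 t) in *. set (f2 := pos_of a p2 t) in *.
  set (z1 := RInt (mom_of l a b c1 p1) 0 t) in *. set (z2 := RInt (mom_of l a b c2 p2) 0 t) in *.
  replace (b + z1 - (1 + l) / 2 * (f1 * f1 - a * a) - (b + z2 - (1 + l) / 2 * (f2 * f2 - a * a)))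
    with ((z1 - z2) + - ((1 + l) / 2 * ((f1 + f2) * (f1 - f2)))) by field.
  eapply Rle_trans; [apply Rabs_triang|].
  rewrite Rabs_Ropp, Rabs_mult, Rabs_mult, (Rabs_pos_eq ((1 + l) / 2)) by lra.
  assert (hC : 0 <= C) by apply Rabs_pos.
  assert (hprod : Rabs (f1 + f2) * Rabs (f1 - f2) <= 2 * (Rabs a + T) * D)
    by (apply Rmult_le_compat; trivial; apply Rabs_pos).
  assert (hm' : Rabs (z1 - z2) <= T * (C + (2 + 4 * l) * D)).
  { eapply Rle_trans; [apply hm|]. apply Rmult_le_compat_r; [|lra].
    assert (0 <= (2 + 4 * l) * D) by (apply Rmult_le_pos; lra). lra. }
  apply Rmult_le_compat_l with (r := (1 + l) / 2) in hprod; [|lra].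
  lra.
Qed.

Definition orbit (c : R) (p : R -> R) : Prop :=
  (forall x, continuous p x) /\ forall t, 0 <= t -> p t = vel_of l a b c p t.

Lemma orbit_exists (c : R) : exists p, orbit c p.
Proof.
  apply (picard_solution (vel_of l a b c)). split.
  - intros p hp x. apply continuous_vel_of, hp.
  - intros T hT. destruct (vel_of_lipschitz T hT) as [K [hK hlip]].
    exists K; split; trivial. intros p1 p2 h1 h2 t ht.
    specialize (hlip c c p1 p2 h1 h2 t ht).
    rewrite Rminus_diag, Rabs_R0 in hlip. lra.
Qed.

(** Gronwall with A = T |c1 - c2| gives the velocity bound with constant [M]. The acceleration is
    explicit in the velocity, so its bound follows: 1 from [c] itself, (2 + 4l) T M from the source,
    and the last summand from the product of position and clamped velocity. The shooting conditions
    involve both quantities. *)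
Lemma orbit_lipschitz (T : R) : 0 <= T -> exists K, 0 < K /\
  forall c1 c2 p1 p2, orbit c1 p1 -> orbit c2 p2 -> forall t, 0 <= t <= T ->
    Rabs (p1 t - p2 t) <= K * Rabs (c1 - c2) /\
    Rabs (acc_of l a b c1 p1 t - acc_of l a b c2 p2 t) <= K * Rabs (c1 - c2).
Proof.
  intros hT. destruct (vel_of_lipschitz T hT) as [K [hK hlip]].
  set (M := 2 * T * exp (2 * K * T)).
  assert (hM : 0 <= M) by (apply Rmult_le_pos; [lra | left; apply exp_pos]).
  assert (ha := Rabs_pos a).
  exists (M + 1 + (2 + 4 * l) * (T * M) + (1 + l) * (T * M + (Rabs a + T) * M)).
  assert (hTM : 0 <= T * M) by (apply Rmult_le_pos; trivial).
  assert (haM : 0 <= (Rabs a + T) * M) by (apply Rmult_le_pos; lra).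
  assert (hlTM : 0 <= (2 + 4 * l) * (T * M)) by (apply Rmult_le_pos; lra).
  assert (hsum : 0 <= (1 + l) * (T * M + (Rabs a + T) * M)) by (apply Rmult_le_pos; lra).
  split; [lra|].
  intros c1 c2 p1 p2 [h1 e1] [h2 e2].
  set (C := Rabs (c1 - c2)). assert (hC : 0 <= C) by apply Rabs_pos.
  assert (hp : forall t, 0 <= t <= T -> Rabs (p1 t - p2 t) <= M * C).
  { intros t ht.
    eapply Rle_trans; [apply (gronwall p1 p2 (T * C) K T); trivial|].
    - apply Rmult_le_pos; trivial.
    - intros r hr. rewrite e1, e2 by lra. apply hlip; trivial.
    - assert (exp (2 * K * t) <= exp (2 * K * T)).
      { destruct (Req_dec t T) as [->|]; [lra | left; apply exp_increasing; nra]. }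
      replace (M * C) with (2 * (T * C) * exp (2 * K * T)) by (unfold M; ring).
      apply Rmult_le_compat_l; trivial.
      assert (0 <= T * C) by (apply Rmult_le_pos; trivial). lra. }
  intros t ht.
  assert (hd : dist_int p1 p2 t <= T * M * C).
  { eapply Rle_trans.
    - apply (dist_int_bound p1 p2 (fun _ => M * C)); trivial; try lra.
      + intros; apply continuous_const.
      + intros r hr; apply hp; lra.
    - rewrite RInt_const. unfold scal; simpl; unfold mult; simpl.
      assert (0 <= M * C) by (apply Rmult_le_pos; trivial). nra. }
  assert (hm := mom_of_lipschitz c1 c2 p1 p2 h1 h2 t (proj1 ht)).
  assert (hf := pos_of_lipschitz p1 p2 h1 h2 t (proj1 ht)).
  assert (hb := pos_of_bound p2 h2 t (proj1 ht)).
  assert (hcl := clamp_lipschitz (p1 t) (p2 t)).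
  assert (hcb := clamp_bounds (p1 t)).
  specialize (hp t ht). unfold acc_of. fold C in hm.
  set (f1 := pos_of a p1 t) in *. set (f2 := pos_of a p2 t) in *.
  set (z1 := mom_of l a b c1 p1 t) in *. set (z2 := mom_of l a b c2 p2 t) in *.
  set (k1 := clamp (p1 t)) in *. set (k2 := clamp (p2 t)) in *.
  assert (hTMC : 0 <= T * M * C) by (apply Rmult_le_pos; trivial).
  assert (haMC : 0 <= (Rabs a + T) * M * C) by (apply Rmult_le_pos; trivial).
  assert (hMC : 0 <= M * C) by (apply Rmult_le_pos; trivial).
  split.
  - eapply Rle_trans; [apply hp|]. apply Rmult_le_compat_r; trivial. lra.
  - replace (z1 - (1 + l) * f1 * k1 - (z2 - (1 + l) * f2 * k2))
      with ((z1 - z2) + - ((1 + l) * ((f1 - f2) * k1 + f2 * (k1 - k2)))) by ring.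
    eapply Rle_trans; [apply Rabs_triang|].
    rewrite Rabs_Ropp, Rabs_mult, (Rabs_pos_eq (1 + l)) by lra.
    assert (hs : Rabs ((f1 - f2) * k1 + f2 * (k1 - k2)) <= T * M * C + (Rabs a + T) * M * C).
    { eapply Rle_trans; [apply Rabs_triang|]. rewrite !Rabs_mult, (Rabs_pos_eq k1) by lra.
      apply Rplus_le_compat.
      - assert (h := Rabs_pos (f1 - f2)). nra.
      - rewrite Rmult_assoc. apply Rmult_le_compat; try apply Rabs_pos; lra. }
    apply Rmult_le_compat_l with (r := 1 + l) in hs; [|lra].
    assert (hd' : (2 + 4 * l) * dist_int p1 p2 t <= (2 + 4 * l) * (T * M * C))
      by (apply Rmult_le_compat_l; lra).
    lra.
Qed.

Lemma orbit_unique (c : R) (p1 p2 : R -> R) : orbit c p1 -> orbit c p2 ->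
  forall t, 0 <= t -> p1 t = p2 t /\ acc_of l a b c p1 t = acc_of l a b c p2 t.
Proof.
  intros h1 h2 t ht. destruct (orbit_lipschitz t ht) as [K [hK hlip]].
  destruct (hlip c c p1 p2 h1 h2 t (conj ht (Rle_refl t))) as [hv ha].
  rewrite Rminus_diag, Rabs_R0, Rmult_0_r in hv, ha.
  split; apply Rminus_diag_uniq.
  - destruct (Req_dec (p1 t - p2 t) 0) as [|H]; trivial. apply Rabs_pos_lt in H. lra.
  - destruct (Req_dec (acc_of l a b c p1 t - acc_of l a b c p2 t) 0) as [|H]; trivial.
    apply Rabs_pos_lt in H. lra.
Qed.

End Orbit.

(** * Shooting *)

Lemma is_derive_nondecreasing (h dh : R -> R) (x y : R) : x <= y ->
  (forall t, x <= t <= y -> is_derive h t (dh t)) ->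
  (forall t, x <= t <= y -> 0 <= dh t) -> h x <= h y.
Proof.
  intros hxy hd hpos.
  destruct (MVT_gen h x y dh) as [z [hz e]]; rewrite Rmin_left, Rmax_right in * by trivial.
  - intros t ht; apply hd; lra.
  - intros t ht; apply continuity_pt_filterlim, (ex_derive_continuous (V := R_NormedModule)).
    eexists; apply hd, ht.
  - specialize (hpos z hz). nra.
Qed.

Lemma is_derive_pos_right (h : R -> R) (t d : R) : is_derive h t d -> 0 < d ->
  exists eta, 0 < eta /\ forall s, t < s < t + eta -> h t < h s.
Proof.
  intros hd hpos. apply is_derive_Reals in hd.
  destruct (hd (d / 2)) as [eta heta]; [lra|].
  exists eta; split; [apply cond_pos|]. intros s hs.
  specialize (heta (s - t)). replace (t + (s - t)) with s in heta by ring.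
  assert (hlt : Rabs ((h s - h t) / (s - t) - d) < d / 2).
  { apply heta; [lra|]. rewrite Rabs_pos_eq; lra. }
  apply Rabs_def2 in hlt.
  assert (hq : 0 < (h s - h t) / (s - t)) by lra.
  assert (hm := Rmult_lt_0_compat _ _ hq (proj2 (Rlt_0_minus _ _) (proj1 hs))).
  replace ((h s - h t) / (s - t) * (s - t)) with (h s - h t) in hm by (field; lra). lra.
Qed.

Lemma continuous_pos_near (h : R -> R) (t : R) : continuous h t -> 0 < h t ->
  exists eta, 0 < eta /\ forall s, Rabs (s - t) < eta -> 0 < h s.
Proof.
  intros hc hpos.
  destruct (proj1 (filterlim_locally h (h t)) hc (mkposreal _ hpos)) as [eta heta].
  exists eta; split; [apply cond_pos|]. intros s hs.
  specialize (heta s hs). change (Rabs (h s - h t) < h t) in heta.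
  apply Rabs_def2 in heta. lra.
Qed.

(** The zero is the supremum of the times up to which [h] has stayed positive; continuity excludes
    either sign there. *)
Lemma first_zero (h : R -> R) (t1 : R) : (forall t, 0 <= t -> continuous h t) ->
  0 < h 0 -> 0 <= t1 -> h t1 <= 0 ->
  exists t, 0 < t <= t1 /\ h t = 0 /\ forall r, 0 <= r < t -> 0 < h r.
Proof.
  intros hc h0 ht1 hle.
  set (S := fun t => 0 <= t /\ forall r, 0 <= r <= t -> 0 < h r).
  assert (hub : forall t, S t -> t < t1).
  { intros t [ht hr]. destruct (Rlt_le_dec t t1); trivial. specialize (hr t1). lra. }
  destruct (completeness S) as [m [hm1 hm2]].
  - exists t1. intros t hS. left; apply hub, hS.
  - exists 0. split; [lra|]. intros r hr. replace r with 0 by lra. trivial.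
  - assert (hbefore : forall r, 0 <= r < m -> 0 < h r).
    { intros r hr. destruct (Rlt_le_dec 0 (h r)) as [|hneg]; trivial.
      exfalso. assert (m <= r); [|lra]. apply hm2. intros t [ht hS].
      destruct (Rle_dec t r); trivial. specialize (hS r). lra. }
    assert (hm0 : 0 <= m).
    { apply hm1. split; [lra|]. intros r hr. replace r with 0 by lra. trivial. }
    assert (hmt : m <= t1) by (apply hm2; intros t hS; left; apply hub, hS).
    assert (hnpos : ~ 0 < h m).
    { intros hpos. destruct (continuous_pos_near h m (hc m hm0) hpos) as [eta [he hs]].
      assert (S (m + eta / 2)).
      { split; [lra|]. intros r hr. destruct (Rlt_le_dec r m); [apply hbefore; lra|].
        apply hs. rewrite Rabs_pos_eq; lra. }
      specialize (hm1 _ H). lra. }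
    assert (hnneg : ~ h m < 0).
    { intros hneg.
      destruct (continuous_pos_near (fun t => - h t) m) as [eta [he hs]].
      - apply (continuous_opp h), hc, hm0.
      - lra.
      - destruct (Req_dec m 0) as [->|]; [lra|].
        assert (hx : 0 <= Rmax 0 (m - eta / 2) < m) by (split; [apply Rmax_l | apply Rmax_lub_lt; lra]).
        specialize (hbefore _ hx). specialize (hs (Rmax 0 (m - eta / 2))).
        assert (hy := Rmax_r 0 (m - eta / 2)).
        rewrite Rabs_left in hs by lra. lra. }
    assert (hz : h m = 0) by lra.
    exists m; repeat split; trivial.
    destruct (Req_dec m 0) as [e|]; [rewrite e in hz|]; lra.
Qed.

(** N = E^2 + D^2 satisfies |N'| <= K N, so N exp(Kt) is nondecreasing and N exp(-Kt) is
    nonincreasing; a zero of N therefore spreads in both directions. It is applied backward from the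
    corner of the shooting region and forward from time 0 in the comparison of solutions. *)
Lemma linear_system_zero (E D a b d : R -> R) (T x0 : R) :
  (forall t, 0 <= t <= T -> is_derive E t (a t * D t)) ->
  (forall t, 0 <= t <= T -> is_derive D t (b t * E t + d t * D t)) ->
  (forall t, 0 <= t <= T -> continuous a t) ->
  (forall t, 0 <= t <= T -> continuous b t) ->
  (forall t, 0 <= t <= T -> continuous d t) ->
  0 <= x0 <= T -> E x0 = 0 -> D x0 = 0 ->
  forall t, 0 <= t <= T -> E t = 0 /\ D t = 0.
Proof.
  intros hE hD ca cb cd hx0 eE eD t ht.
  destruct (continuous_bounded a T) as [Ka [hKa ba]]; [lra|trivial|].
  destruct (continuous_bounded b T) as [Kb [hKb bb]]; [lra|trivial|].
  destruct (continuous_bounded d T) as [Kd [hKd bd]]; [lra|trivial|].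
  (* N' = 2(a + b) E D + 2 d D^2, with 2|E D| <= N and D^2 <= N. *)
  set (K := Ka + Kb + 2 * Kd).
  set (N := fun s => E s * E s + D s * D s).
  assert (hN : forall s, 0 <= N s) by (intros s; unfold N; nra).
  assert (hb : forall s, 0 <= s <= T ->
    Rabs (2 * (a s + b s) * (E s * D s) + 2 * d s * (D s * D s)) <= K * N s).
  { intros s hs. specialize (ba s hs). specialize (bb s hs). specialize (bd s hs).
    eapply Rle_trans; [apply Rabs_triang|]. rewrite !Rabs_mult, (Rabs_pos_eq 2) by lra.
    assert (hab := Rabs_triang (a s) (b s)).
    assert (hed : 2 * (Rabs (E s) * Rabs (D s)) <= N s).
    { unfold N. rewrite <- (Rabs_pos_eq (E s * E s)), <- (Rabs_pos_eq (D s * D s)), !Rabs_mult by nra.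
      assert (h := Rle_0_sqr (Rabs (E s) - Rabs (D s))). unfold Rsqr in h. lra. }
    assert (hdd : Rabs (D s) * Rabs (D s) <= N s).
    { rewrite <- Rabs_mult, Rabs_pos_eq by nra. unfold N. nra. }
    assert (0 <= Rabs (E s) * Rabs (D s)) by (apply Rmult_le_pos; apply Rabs_pos).
    assert (0 <= Rabs (D s) * Rabs (D s)) by (apply Rmult_le_pos; apply Rabs_pos).
    assert (Rabs (a s + b s) * (2 * (Rabs (E s) * Rabs (D s))) <= (Ka + Kb) * N s)
      by (apply Rmult_le_compat; try apply Rabs_pos; lra).
    assert (Rabs (d s) * (Rabs (D s) * Rabs (D s)) <= Kd * N s)
      by (apply Rmult_le_compat; try apply Rabs_pos; lra).
    unfold K. lra. }
  assert (hdN : forall k s, 0 <= s <= T -> is_derive (fun s => N s * exp (k * s)) s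
    ((2 * (a s + b s) * (E s * D s) + 2 * d s * (D s * D s) + k * N s) * exp (k * s))).
  { intros k s hs. unfold N. specialize (hE s hs). specialize (hD s hs).
    assert (e1 : Derive (fun x => E x) s = a s * D s) by (apply is_derive_unique, hE).
    assert (e2 : Derive (fun x => D x) s = b s * E s + d s * D s)
      by (apply is_derive_unique, hD).
    auto_derive.
    - repeat split; eexists; eauto.
    - rewrite e1, e2. ring. }
  assert (hz : N x0 = 0) by (unfold N; rewrite eE, eD; ring).
  assert (hNt : N t <= 0).
  { destruct (Rle_dec t x0) as [hle|hgt].
    - assert (h : N t * exp (K * t) <= N x0 * exp (K * x0)).
      { eapply (is_derive_nondecreasing (fun s => N s * exp (K * s))); [exact hle| |].
        - intros s hs; apply hdN; lra.
        - intros s hs. apply Rmult_le_pos; [|left; apply exp_pos].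
          specialize (hb s ltac:(lra)). apply Rabs_le_between in hb. lra. }
      rewrite hz, Rmult_0_l in h. assert (he := exp_pos (K * t)).
      destruct (Rlt_le_dec 0 (N t)); [nra|trivial].
    - assert (h : - (N x0 * exp (- K * x0)) <= - (N t * exp (- K * t))).
      { apply (is_derive_nondecreasing (fun s => - (N s * exp (- K * s)))
          (fun s => - ((2 * (a s + b s) * (E s * D s) + 2 * d s * (D s * D s) + - K * N s) * exp (- K * s))));
          [lra| |].
        - intros s hs. apply (is_derive_opp (fun s => N s * exp (- K * s))), hdN; lra.
        - intros s hs. rewrite <- Ropp_mult_distr_l_reverse.
          apply Rmult_le_pos; [|left; apply exp_pos].
          specialize (hb s ltac:(lra)). apply Rabs_le_between in hb. lra. }
      rewrite hz, Rmult_0_l in h. assert (he := exp_pos (- K * t)).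
      destruct (Rlt_le_dec 0 (N t)); [nra|trivial]. }
  assert (h1 := Rle_0_sqr (E t)). assert (h2 := Rle_0_sqr (D t)). unfold Rsqr in *.
  unfold N in hNt.
  split; apply Rsqr_0_uniq; unfold Rsqr; lra.
Qed.

(** * The turning and overshooting sets, and the orbit between them *)

Section Shooting.

Variables (l a b : R).
Hypotheses (hl : 0 < l) (hb0 : 0 < b) (hb1 : b < 1).

(** A differentiable substitute for [acc_of], which contains the clamp and so may have corners.
    [vel_of] is used instead of [p] because an orbit agrees with it only on the half-line, while
    [vel_of] has two-sided derivatives at 0 as well. *)
Definition acc_smooth (c : R) (p : R -> R) (t : R) : R :=
  mom_of l a b c p t - (1 + l) * pos_of a p t * vel_of l a b c p t.

Lemma acc_smooth_eq (c : R) (p : R -> R) (t : R) : orbit l a b c p -> 0 <= t ->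
  0 <= p t <= 1 -> acc_of l a b c p t = acc_smooth c p t.
Proof.
  intros [hp e] ht hr. unfold acc_of, acc_smooth. rewrite clamp_id, <- e; trivial.
Qed.

(** Where the clamp is inactive the original equation for f''' reappears: the term (1 + l) f'^2 of
    [source] cancels against the product rule for f f'. Only the value of [p] at [t] enters, so the
    formula also holds when [p t] is 0 or 1. *)
Lemma is_derive_acc_smooth (c : R) (p : R -> R) (t : R) : orbit l a b c p -> 0 <= t ->
  0 <= p t <= 1 ->
  is_derive (acc_smooth c p) t
    (- (1 + l) * pos_of a p t * acc_smooth c p t - 2 * l * (1 - p t) * p t).
Proof.
  intros ho ht hr. rewrite <- acc_smooth_eq by trivial.
  destruct ho as [hp e].
  assert (h1 := is_derive_mom_of l a b hl c p hp t).
  assert (h2 := is_derive_pos_of a p hp t).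
  assert (h3 := is_derive_vel_of l a b hl c p hp t).
  unfold acc_smooth.
  assert (e1 : Derive (fun x => mom_of l a b c p x) t = source l (p t))
    by (apply is_derive_unique, h1).
  assert (e2 : Derive (fun x => pos_of a p x) t = clamp (p t)) by (apply is_derive_unique, h2).
  assert (e3 : Derive (fun x => vel_of l a b c p x) t = acc_of l a b c p t)
    by (apply is_derive_unique, h3).
  auto_derive.
  - repeat split; eexists; eauto.
  - rewrite e1, e2, e3, <- e by trivial. unfold source. rewrite clamp_id by trivial. ring.
Qed.

Definition turns (c : R) : Prop := exists p, orbit l a b c p /\
  exists t, 0 <= t /\ acc_of l a b c p t < 0 /\ forall r, 0 <= r <= t -> p r < 1.

Definition overshoots (c : R) : Prop := exists p, orbit l a b c p /\
  exists t, 0 <= t /\ 1 < p t /\ forall r, 0 <= r <= t -> 0 < acc_of l a b c p r.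

(** The conditions are strict on a compact time interval, so the maximum of [p] and the acceleration
    at [t] leave a positive margin; dividing it by the Lipschitz constant gives [del]. *)
Lemma turns_open (c : R) : turns c -> exists del, 0 < del /\ forall d, Rabs (d - c) < del -> turns d.
Proof.
  intros [p [ho [t [ht [hneg hlt]]]]].
  destruct (continuity_ab_maj p 0 t ht) as [m [hm hmt]].
  { intros x _. apply continuity_pt_filterlim, ho. }
  destruct (orbit_lipschitz l a b hl t ht) as [K [hK hlip]].
  specialize (hlt m hmt).
  exists (Rmin (1 - p m) (- acc_of l a b c p t) / K). split.
  { apply Rdiv_lt_0_compat; trivial. apply Rmin_glb_lt; lra. }
  intros d hd.
  assert (hd' : K * Rabs (d - c) < Rmin (1 - p m) (- acc_of l a b c p t)).
  { apply Rmult_lt_compat_l with (r := K) in hd; trivial.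
    replace (K * (Rmin (1 - p m) (- acc_of l a b c p t) / K))
      with (Rmin (1 - p m) (- acc_of l a b c p t)) in hd by (field; lra). trivial. }
  assert (h1 := Rmin_l (1 - p m) (- acc_of l a b c p t)).
  assert (h2 := Rmin_r (1 - p m) (- acc_of l a b c p t)).
  destruct (orbit_exists l a b hl d) as [p' ho'].
  exists p'; split; trivial. exists t; repeat split; trivial.
  - destruct (hlip d c p' p ho' ho t ltac:(lra)) as [_ h]. apply Rabs_le_between in h. lra.
  - intros r hr. destruct (hlip d c p' p ho' ho r hr) as [h _].
    apply Rabs_le_between in h. specialize (hm r hr). lra.
Qed.

Lemma overshoots_open (c : R) :
  overshoots c -> exists del, 0 < del /\ forall d, Rabs (d - c) < del -> overshoots d.
Proof.
  intros [p [ho [t [ht [hgt hpos]]]]].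
  destruct (continuity_ab_min (acc_of l a b c p) 0 t ht) as [m [hm hmt]].
  { intros x _. apply continuity_pt_filterlim, continuous_acc_of; [trivial | apply ho]. }
  destruct (orbit_lipschitz l a b hl t ht) as [K [hK hlip]].
  specialize (hpos m hmt).
  exists (Rmin (p t - 1) (acc_of l a b c p m) / K). split.
  { apply Rdiv_lt_0_compat; trivial. apply Rmin_glb_lt; lra. }
  intros d hd.
  assert (hd' : K * Rabs (d - c) < Rmin (p t - 1) (acc_of l a b c p m)).
  { apply Rmult_lt_compat_l with (r := K) in hd; trivial.
    replace (K * (Rmin (p t - 1) (acc_of l a b c p m) / K))
      with (Rmin (p t - 1) (acc_of l a b c p m)) in hd by (field; lra). trivial. }
  assert (h1 := Rmin_l (p t - 1) (acc_of l a b c p m)).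
  assert (h2 := Rmin_r (p t - 1) (acc_of l a b c p m)).
  destruct (orbit_exists l a b hl d) as [p' ho'].
  exists p'; split; trivial. exists t; repeat split; trivial.
  - destruct (hlip d c p' p ho' ho t ltac:(lra)) as [h _]. apply Rabs_le_between in h. lra.
  - intros r hr. destruct (hlip d c p' p ho' ho r hr) as [_ h].
    apply Rabs_le_between in h. specialize (hm r hr). lra.
Qed.

(** Both witnesses follow the same orbit, and whichever of the two times comes first violates the
    condition that the other imposes up to its own time. *)
Lemma turns_overshoots_disjoint (c : R) : turns c -> ~ overshoots c.
Proof.
  intros [p [ho [t [ht [hneg hlt]]]]] [p' [ho' [t' [ht' [hgt hpos]]]]].
  destruct (Rle_dec t t') as [hle|hle].
  - destruct (orbit_unique l a b hl c p p' ho ho' t ht) as [_ e].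
    specialize (hpos t). lra.
  - destruct (orbit_unique l a b hl c p p' ho ho' t' ht') as [e _].
    specialize (hlt t'). lra.
Qed.

Lemma orbit_0 (c : R) (p : R -> R) : orbit l a b c p -> p 0 = b.
Proof. intros [hp e]. rewrite e by lra. apply vel_of_0. Qed.

Lemma acc_of_0 (c : R) (p : R -> R) : orbit l a b c p -> acc_of l a b c p 0 = c.
Proof.
  intros ho. unfold acc_of. rewrite mom_of_0, pos_of_0, (orbit_0 c p ho), clamp_id by lra. ring.
Qed.

(** When f'' = 0 and 0 < f' < 1, the equation reduces to f''' = -2l (1 - f') f' < 0, so f'' becomes
    negative immediately afterwards, before f' can reach 1. *)
Lemma turns_after_critical (c : R) (p : R -> R) (t : R) : orbit l a b c p -> 0 <= t ->
  0 < p t -> (forall r, 0 <= r <= t -> p r < 1) -> acc_of l a b c p t = 0 -> turns c.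
Proof.
  intros ho ht hpos hlt hz.
  assert (hlt1 := hlt t ltac:(lra)).
  assert (hd := is_derive_acc_smooth c p t ho ht ltac:(lra)).
  rewrite <- acc_smooth_eq, hz in hd by (trivial; lra).
  apply (is_derive_opp (acc_smooth c p)) in hd.
  destruct (is_derive_pos_right _ _ _ hd) as [e1 [he1 h1]].
  { unfold opp; simpl.
    assert (0 < l * ((1 - p t) * p t)) by (repeat apply Rmult_lt_0_compat; lra). lra. }
  destruct (continuous_pos_near p t) as [e2 [he2 h2]]; [apply ho | trivial |].
  destruct (continuous_pos_near (fun s => 1 - p s) t) as [e3 [he3 h3]].
  { apply (continuous_minus (fun _ => 1) p); [apply continuous_const | apply ho]. }
  { lra. }
  set (e := Rmin e1 (Rmin e2 e3) / 2).
  assert (hm1 := Rmin_l e1 (Rmin e2 e3)). assert (hm2 := Rmin_r e1 (Rmin e2 e3)).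
  assert (hm3 := Rmin_l e2 e3). assert (hm4 := Rmin_r e2 e3).
  assert (he : 0 < Rmin e1 (Rmin e2 e3)) by (repeat apply Rmin_glb_lt; trivial).
  exists p; split; trivial. exists (t + e). unfold e. repeat split.
  - lra.
  - specialize (h1 (t + e)). specialize (h2 (t + e)). specialize (h3 (t + e)).
    unfold e in *. rewrite Rabs_pos_eq in h2, h3 by lra.
    assert (h4 : opp (acc_smooth c p t) < opp (acc_smooth c p (t + Rmin e1 (Rmin e2 e3) / 2)))
      by (apply h1; lra).
    rewrite <- !acc_smooth_eq in h4 by (trivial; lra).
    unfold opp in h4; simpl in h4. lra.
  - intros r hr. destruct (Rle_dec r t); [apply hlt; lra|].
    specialize (h3 r). rewrite Rabs_pos_eq in h3 by lra. lra.
Qed.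

Lemma turns_0 : turns 0.
Proof.
  destruct (orbit_exists l a b hl 0) as [p ho].
  assert (e := orbit_0 0 p ho).
  apply (turns_after_critical 0 p 0); trivial; try lra.
  - intros r hr. replace r with 0 by lra. lra.
  - apply acc_of_0, ho.
Qed.

Lemma overshoots_large : exists c, 0 < c /\ overshoots c.
Proof.
  assert (ha := Rabs_pos a).
  (* On [0, 1] the first three summands dominate, in order, the initial term (1 + l) a b, the
     integral of the source, and (1 + l) f f'. The remaining 2 keeps the acceleration above 1, so
     the velocity at time 1 is at least b + 1. *)
  set (c := (1 + l) * Rabs a + (1 + 3 * l) + (1 + l) * (Rabs a + 1) + 2).
  assert (hc0 : 0 < c) by (unfold c; nra).
  exists c; split; trivial.
  destruct (orbit_exists l a b hl c) as [p ho].
  exists p; split; trivial. exists 1.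
  assert (hacc : forall r, 0 <= r <= 1 -> 1 < acc_of l a b c p r).
  { intros r hr. unfold acc_of. destruct ho as [hp e].
    assert (h1 := mom_of_bound l a b hl c p hp r (proj1 hr)).
    assert (h2 := pos_of_bound a p hp r (proj1 hr)).
    assert (h3 := clamp_bounds (p r)).
    apply Rabs_le_between in h1.
    assert (h4 : Rabs (pos_of a p r * clamp (p r)) <= Rabs a + 1).
    { rewrite Rabs_mult, (Rabs_pos_eq (clamp (p r))) by lra.
      assert (h := Rabs_pos (pos_of a p r)). nra. }
    assert (h5 : Rabs (a * b) <= Rabs a) by (rewrite Rabs_mult, (Rabs_pos_eq b) by lra; nra).
    apply Rabs_le_between in h4. apply Rabs_le_between in h5.
    assert ((1 + l) * (pos_of a p r * clamp (p r)) <= (1 + l) * (Rabs a + 1))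
      by (apply Rmult_le_compat_l; lra).
    assert ((1 + l) * (- Rabs a) <= (1 + l) * (a * b)) by (apply Rmult_le_compat_l; lra).
    assert ((1 + 3 * l) * r <= 1 + 3 * l) by nra.
    unfold c in *. lra. }
  split; [lra|]. split.
  - destruct ho as [hp e]. rewrite e by lra.
    assert (h : vel_of l a b c p 0 - 0 <= vel_of l a b c p 1 - 1).
    { apply (is_derive_nondecreasing (fun x => vel_of l a b c p x - x)
        (fun x => acc_of l a b c p x - 1)); [lra| |].
      - intros t ht. apply (is_derive_minus (vel_of l a b c p) (fun x => x)).
        + apply is_derive_vel_of; trivial.
        + apply (is_derive_id (K := R_AbsRing)).
      - intros t ht. specialize (hacc t ht). lra. }
    rewrite vel_of_0 in h. lra.
  - intros r hr. specialize (hacc r hr). lra.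
Qed.

(** The supremum is taken over turning values below one overshooting [C], so nothing needs to be
    known about the shape of the turning set. If the supremum turned, openness would give a larger
    turning value below [C]; if it overshot, a whole left neighbourhood would contain no turning
    value. *)
Lemma critical_shot : exists c, 0 < c /\ ~ turns c /\ ~ overshoots c.
Proof.
  destruct overshoots_large as [C [hC hov]].
  destruct (completeness (fun c => c <= C /\ turns c)) as [m [hm1 hm2]].
  - exists C. intros c [h _]; trivial.
  - exists 0. split; [lra | apply turns_0].
  - assert (hmC : m <= C) by (apply hm2; intros c [h _]; trivial).
    assert (hm0 : 0 <= m) by (apply hm1; split; [lra | apply turns_0]).
    assert (hnt : ~ turns m).
    { intros ht. destruct (turns_open m ht) as [del [hdel hnear]].
      destruct (Req_dec m C) as [e|hne].
      - rewrite e in ht. exact (turns_overshoots_disjoint C ht hov).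
      (* The cap at [C] keeps [d] in the set whose supremum is [m]. *)
      - set (d := Rmin (m + del / 2) C).
        assert (h1 := Rmin_l (m + del / 2) C). assert (h2 := Rmin_r (m + del / 2) C).
        assert (h3 : m < Rmin (m + del / 2) C) by (apply Rmin_glb_lt; lra).
        assert (d <= m); [|unfold d in *; lra].
        apply hm1. split; [trivial|]. apply hnear. unfold d. rewrite Rabs_pos_eq; lra. }
    exists m. split; [|split; trivial].
    + destruct (Req_dec m 0) as [e|]; [|lra]. rewrite e in hnt. destruct (hnt turns_0).
    + intros ho. destruct (overshoots_open m ho) as [del [hdel hnear]].
      assert (m <= m - del / 2); [|lra].
      apply hm2. intros c [hcC hct].
      destruct (Rle_dec c (m - del / 2)) as [|hgt]; trivial.
      assert (hcm : c <= m) by (apply hm1; split; trivial).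
      destruct (turns_overshoots_disjoint c hct). apply hnear.
      rewrite Rabs_left1; lra.
Qed.

Lemma orbit_nondecreasing (c : R) (p : R -> R) (T : R) : orbit l a b c p ->
  (forall r, 0 <= r <= T -> 0 <= acc_of l a b c p r) ->
  forall r, 0 <= r <= T -> b <= p r.
Proof.
  intros [hp e] hacc r hr.
  rewrite e by lra. rewrite <- (vel_of_0 l a b c p) at 1.
  apply (is_derive_nondecreasing _ (acc_of l a b c p)); [lra| |].
  - intros t _. apply is_derive_vel_of; trivial.
  - intros t ht; apply hacc; lra.
Qed.

(** The minimum of f'' and 1 - f' is positive at time 0, and its first zero is the first exit from
    the region. Leaving through f'' = 0 alone means turning, and through f' = 1 alone overshooting;
    both at once is the corner. *)
Lemma critical_orbit (c : R) (p : R -> R) : orbit l a b c p ->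
  0 < c -> ~ turns c -> ~ overshoots c ->
  forall t, 0 <= t -> 0 < acc_of l a b c p t /\ p t < 1.
Proof.
  intros ho hc hnt hno t1 ht1.
  assert (hp := proj1 ho). assert (e := proj2 ho).
  assert (hca := continuous_acc_of l a b hl c p hp).
  set (h := fun t => Rmin (acc_of l a b c p t) (1 - p t)).
  assert (hpos : forall t, 0 < h t -> 0 < acc_of l a b c p t /\ p t < 1).
  { intros t ht. assert (h1 := Rmin_l (acc_of l a b c p t) (1 - p t)).
    assert (h2 := Rmin_r (acc_of l a b c p t) (1 - p t)). unfold h in ht. lra. }
  destruct (Rlt_le_dec 0 (h t1)) as [|hle]; [auto|]. exfalso.
  destruct (first_zero h t1) as [t [ht [hz hbefore]]]; trivial.
  { intros x _. apply (continuous_ext (fun t => (acc_of l a b c p t + (1 - p t) -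
      Rabs (acc_of l a b c p t - (1 - p t))) / 2)).
    - intros s. unfold h, Rmin, Rabs.
      destruct (Rle_dec _ _), (Rcase_abs _); lra.
    - assert (hcp : continuous (fun t => 1 - p t) x)
        by (apply (continuous_minus (fun _ => 1) p); [apply continuous_const | apply hp]).
      apply (continuous_scal_l (fun t => acc_of l a b c p t + (1 - p t) -
        Rabs (acc_of l a b c p t - (1 - p t))) (/ 2)).
      apply (continuous_minus (fun t => acc_of l a b c p t + (1 - p t))
        (fun t => Rabs (acc_of l a b c p t - (1 - p t)))).
      + apply (continuous_plus (acc_of l a b c p) (fun t => 1 - p t)); trivial.
      + apply (continuous_comp (fun t => acc_of l a b c p t - (1 - p t)) Rabs);
          [|apply continuous_Rabs].
        apply (continuous_minus (acc_of l a b c p) (fun t => 1 - p t)); trivial. }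
  { unfold h. rewrite (acc_of_0 c p ho), (orbit_0 c p ho). apply Rmin_glb_lt; lra. }
  assert (h1 := Rmin_l (acc_of l a b c p t) (1 - p t)).
  assert (h2 := Rmin_r (acc_of l a b c p t) (1 - p t)).
  unfold h in hz. rewrite hz in h1, h2.
  assert (hnn : forall r, 0 <= r <= t -> 0 <= acc_of l a b c p r /\ p r <= 1).
  { intros r hr. destruct (Req_dec r t) as [->|]; [lra|].
    destruct (hpos r (hbefore r ltac:(lra))); lra. }
  assert (hbp := orbit_nondecreasing c p t ho (fun r hr => proj1 (hnn r hr))).
  destruct (Req_dec (p t) 1) as [ep|nep].
  - destruct (Req_dec (acc_of l a b c p t) 0) as [ea|nea].
    + (* The constant [1] solves the linear equation satisfied by [p] with the same data at [t]. *)
      assert (hr : forall r, 0 <= r <= t -> 0 <= p r <= 1).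
      { intros r hr. specialize (hbp r hr). destruct (hnn r hr). lra. }
      destruct (linear_system_zero (fun r => 1 - vel_of l a b c p r) (acc_smooth c p)
        (fun _ => -1) (fun r => - (2 * l) * p r) (fun r => - (1 + l) * pos_of a p r) t t)
        with (t := 0) as [h0 _]; try lra.
      * intros r hr'. replace (-1 * acc_smooth c p r) with (minus 0 (acc_of l a b c p r))
          by (rewrite (acc_smooth_eq c p r ho) by (auto; lra); unfold minus, plus, opp; simpl; ring).
        apply (is_derive_minus (fun _ => 1) (vel_of l a b c p)).
        -- apply (is_derive_const (V := R_NormedModule)).
        -- apply is_derive_vel_of; trivial.
      * intros r hr'. rewrite <- e by lra.
        replace (- (2 * l) * p r * (1 - p r) + - (1 + l) * pos_of a p r * acc_smooth c p r)
          with (- (1 + l) * pos_of a p r * acc_smooth c p r - 2 * l * (1 - p r) * p r) by ring.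
        apply is_derive_acc_smooth; auto; lra.
      * intros; apply continuous_const.
      * intros; apply (continuous_scal_r (- (2 * l)) p), hp.
      * intros; apply (continuous_scal_r (- (1 + l)) (pos_of a p)), continuous_pos_of, hp.
      * rewrite <- e; lra.
      * rewrite <- acc_smooth_eq; auto; try lra.
      * rewrite vel_of_0 in h0. lra.
    + assert (hap : 0 < acc_of l a b c p t) by lra.
      destruct (continuous_pos_near _ t (hca t) hap) as [e1 [he1 hn1]].
      destruct (is_derive_pos_right _ t _ (is_derive_vel_of l a b hl c p hp t) hap)
        as [e2 [he2 hn2]].
      assert (hm1 := Rmin_l e1 e2). assert (hm2 := Rmin_r e1 e2).
      assert (hm : 0 < Rmin e1 e2) by (apply Rmin_glb_lt; trivial).
      apply hno. exists p; split; trivial. exists (t + Rmin e1 e2 / 2). repeat split.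
      * lra.
      * rewrite e by lra. rewrite <- ep, e by lra. apply hn2. lra.
      * intros r hr. destruct (Rlt_le_dec r t) as [hlt|hge].
        -- apply hpos, hbefore; lra.
        -- apply hn1. rewrite Rabs_pos_eq; lra.
  - apply hnt, (turns_after_critical c p t); trivial; try lra.
    + specialize (hbp t). lra.
    + intros r hr. destruct (Req_dec r t) as [->|]; [lra|]. apply hpos, hbefore; lra.
    + unfold Rmin in hz. destruct (Rle_dec (acc_of l a b c p t) (1 - p t)); lra.
Qed.

Lemma orbit_limit (c : R) (p : R -> R) : orbit l a b c p ->
  (forall t, 0 <= t -> 0 < acc_of l a b c p t /\ p t < 1) ->
  forall eps, 0 < eps -> exists t, 0 <= t /\ 1 - eps < p t.
Proof.
  intros ho hc eps heps.
  destruct (Classical_Prop.classic (exists t, 0 <= t /\ 1 - eps < p t)) as [|hn]; trivial.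
  exfalso. assert (hle : forall t, 0 <= t -> p t <= 1 - eps).
  { intros t ht. destruct (Rle_dec (p t) (1 - eps)); trivial. exfalso. apply hn; exists t; lra. }
  assert (hp := proj1 ho).
  assert (hbp : forall t, 0 <= t -> b <= p t).
  { intros t ht. apply (orbit_nondecreasing c p t ho); [|lra].
    intros r hr. left. apply hc; lra. }
  assert (hf : forall t, 0 <= t -> a + b * t <= pos_of a p t).
  { intros t ht.
    assert (h : pos_of a p 0 - b * 0 <= pos_of a p t - b * t).
    { apply (is_derive_nondecreasing (fun x => pos_of a p x - b * x) (fun x => clamp (p x) - b));
        trivial.
      - intros r _. apply (is_derive_minus (pos_of a p) (fun x => b * x)).
        + apply is_derive_pos_of, hp.
        + auto_derive; trivial. ring.
      - intros r hr. rewrite clamp_id; specialize (hbp r (proj1 hr));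
          [|destruct (hc r (proj1 hr))]; lra. }
    rewrite pos_of_0 in h. lra. }
  (* The velocity is at least [b], so the position is nonnegative from this time on and the damping
     term in f''' has a favourable sign. *)
  set (T := Rabs a / b).
  assert (hT : 0 <= T) by (apply Rdiv_le_0_compat; [apply Rabs_pos | trivial]).
  assert (hTb : b * T = Rabs a) by (unfold T; field; lra).
  set (k := 2 * l * eps * b).
  assert (hk : 0 < k) by (unfold k; repeat apply Rmult_lt_0_compat; lra).
  assert (hacc : forall t, T <= t -> acc_smooth c p t <= acc_smooth c p T - k * (t - T)).
  { intros t ht.
    assert (h : - acc_smooth c p T - k * T <= - acc_smooth c p t - k * t).
    { apply (is_derive_nondecreasing (fun x => - acc_smooth c p x - k * x)
        (fun x => - (- (1 + l) * pos_of a p x * acc_smooth c p x - 2 * l * (1 - p x) * p x) - k));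
        trivial.
      - intros r hr. apply (is_derive_minus (fun x => - acc_smooth c p x) (fun x => k * x)).
        + apply (is_derive_opp (acc_smooth c p)), is_derive_acc_smooth; trivial; try lra.
          assert (h := hbp r ltac:(lra)). destruct (hc r ltac:(lra)). lra.
        + auto_derive; trivial. ring.
      - intros r hr. destruct (hc r ltac:(lra)) as [h1 h2]. assert (h3 := hbp r ltac:(lra)).
        rewrite (acc_smooth_eq c p r ho) in h1 by lra.
        assert (h4 := hf r ltac:(lra)). assert (h5 := hle r ltac:(lra)).
        assert (h6 : 0 <= pos_of a p r).
        { assert (h := Rle_abs (- a)). rewrite Rabs_Ropp in h.
          assert (b * T <= b * r) by (apply Rmult_le_compat_l; lra). lra. }
        assert (0 <= (1 + l) * (pos_of a p r * acc_smooth c p r))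
          by (repeat apply Rmult_le_pos; lra).
        assert (eps * b <= (1 - p r) * p r) by (apply Rmult_le_compat; lra).
        assert (2 * l * (eps * b) <= 2 * l * ((1 - p r) * p r)) by (apply Rmult_le_compat_l; lra).
        unfold k. lra. }
    lra. }
  assert (hpos : forall t, 0 <= t -> 0 < acc_smooth c p t).
  { intros t ht. destruct (hc t ht). rewrite <- acc_smooth_eq; trivial.
    assert (h := hbp t ht). lra. }
  (* The time at which the linear upper bound for the acceleration vanishes. *)
  set (s := T + acc_smooth c p T / k).
  assert (hsT := hpos T hT).
  assert (h0 : 0 < acc_smooth c p T / k) by (apply Rdiv_lt_0_compat; trivial).
  assert (h1 := hacc s ltac:(unfold s; lra)). assert (h2 := hpos s ltac:(unfold s; lra)).
  replace (k * (s - T)) with (acc_smooth c p T) in h1 by (unfold s; field; lra). lra.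
Qed.

End Shooting.

(** * The critical orbit as a convex solution *)

Lemma is_derive_D_in (f f' : R -> R) (t d : R) : is_derive f t d -> f' t = d ->
  D_in f f' half_line t.
Proof.
  intros h <-. apply is_derive_Reals in h. apply derivable_pt_lim_D_in in h.
  intros eps heps. destruct (h eps heps) as [alp [ha hl]]. exists alp; split; trivial.
  intros x [[_ hne] hx]. apply hl. split; trivial. split; trivial. unfold no_cond; trivial.
Qed.

Lemma convex_solution_exists (l a b : R) (hl : 0 < l) (hb0 : 0 < b) (hb1 : b < 1) :
  exists f, convex_solution l a b f.
Proof.
  destruct (critical_shot l a b hl hb0 hb1) as [c [hc [hnt hno]]].
  destruct (orbit_exists l a b hl c) as [p ho].
  assert (hcr := critical_orbit l a b hl hb0 hb1 c p ho hc hnt hno).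
  assert (hp := proj1 ho). assert (e := proj2 ho).
  assert (hmono : forall s t, 0 <= s <= t -> p s <= p t).
  { intros s t hst. rewrite (e s), (e t) by lra.
    apply (is_derive_nondecreasing _ (acc_of l a b c p)); [lra| |].
    - intros r _. apply is_derive_vel_of; trivial.
    - intros r hr. left; apply hcr; lra. }
  assert (hr : forall t, 0 <= t -> 0 <= p t <= 1).
  { intros t ht. destruct (hcr t ht). specialize (hmono 0 t).
    rewrite (orbit_0 l a b c p ho) in hmono. lra. }
  (* The last witness is f''' as prescribed by the equation, so that the equation becomes an
     identity and the work lies in the derivative of [acc_smooth]. *)
  exists (pos_of a p), (vel_of l a b c p), (acc_smooth l a b c p),
    (fun t => - (1 + l) * pos_of a p t * acc_smooth l a b c p t - 2 * l * (1 - p t) * p t).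
  split; [split|]; unfold half_line.
  - intros t ht. apply (is_derive_D_in _ _ _ (clamp (p t))).
    + apply is_derive_pos_of, hp.
    + rewrite clamp_id, <- e; auto.
  - intros t ht. apply (is_derive_D_in _ _ _ (acc_of l a b c p t)).
    + apply is_derive_vel_of; trivial.
    + symmetry; apply acc_smooth_eq; auto.
  - intros t ht. eapply is_derive_D_in; [apply is_derive_acc_smooth; auto | trivial].
  - intros t ht. rewrite <- e by trivial. ring.
  - apply pos_of_0.
  - apply vel_of_0.
  - apply is_lim_spec. intros eps.
    destruct (orbit_limit l a b hl hb0 c p ho hcr eps (cond_pos eps)) as [T [hT hlt]].
    exists T. intros t ht. rewrite <- e by lra.
    assert (h1 := hmono T t ltac:(lra)). destruct (hcr t ltac:(lra)) as [_ h2].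
    rewrite Rabs_left; lra.
  - intros t ht. rewrite <- acc_smooth_eq; auto. apply hcr; trivial.
Qed.

(** * Comparison of convex solutions *)

Lemma is_derive_continuous (h : R -> R) (t d : R) : is_derive h t d -> continuous h t.
Proof.
  intros hd. apply (ex_derive_continuous (V := R_NormedModule)). exists d; exact hd.
Qed.

Lemma is_derive_increasing (h dh : R -> R) (x y : R) : x < y ->
  (forall t, x <= t <= y -> is_derive h t (dh t)) ->
  (forall t, x <= t <= y -> 0 < dh t) -> h x < h y.
Proof.
  intros hxy hd hpos.
  destruct (MVT_gen h x y dh) as [z [hz e]]; rewrite Rmin_left, Rmax_right in * by lra.
  - intros t ht; apply hd; lra.
  - intros t ht; apply continuity_pt_filterlim, (is_derive_continuous h t (dh t)), hd, ht.
  - specialize (hpos z hz). nra.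
Qed.

(** Since [u t = 0], the difference quotient of the product is that of [u] times [k s], so
    continuity of [k] suffices. *)
Lemma is_derive_mult_zero (u k : R -> R) (t d : R) :
  is_derive u t d -> u t = 0 -> continuous k t ->
  is_derive (fun s => u s * k s) t (d * k t).
Proof.
  intros hu hz hk.
  apply is_derive_Reals. apply is_derive_Reals in hu.
  apply continuity_pt_filterlim in hk.
  apply (proj1 (derivable_pt_lim_D_in (fun s => u s * k s) (fun _ => d * k t) t)).
  apply (proj2 (derivable_pt_lim_D_in u (fun _ => d) t)) in hu.
  unfold D_in in *.
  apply (limit1_ext (fun s => (u s - u t) / (s - t) * k s)).
  - intros s [_ hs]. rewrite hz. field. lra.
  - apply limit_mul; trivial.
Qed.

(** Caratheodory's form of the derivative: the difference quotient at [t], completed by [d], is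
    continuous at [t] when [d] is the derivative. *)
Definition slope (h : R -> R) (t d s : R) : R :=
  if Req_dec_T s t then d else (h s - h t) / (s - t).

Lemma slope_mult (h : R -> R) (t d s : R) : slope h t d s * (s - t) = h s - h t.
Proof.
  unfold slope. destruct (Req_dec_T s t) as [->|]; [ring | field; lra].
Qed.

Lemma slope_at (h : R -> R) (t d : R) : slope h t d t = d.
Proof. unfold slope. destruct (Req_dec_T t t); congruence. Qed.

Lemma continuous_slope (h : R -> R) (t d : R) : is_derive h t d -> continuous (slope h t d) t.
Proof.
  intros hd. apply continuity_pt_filterlim. apply is_derive_Reals in hd.
  apply (proj2 (derivable_pt_lim_D_in h (fun _ => d) t)) in hd.
  unfold continuity_pt, continue_in. rewrite slope_at.
  apply (limit1_ext (fun s => (h s - h t) / (s - t))); [|exact hd].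
  intros s [_ hs]. unfold slope. destruct (Req_dec_T s t); congruence.
Qed.

(** Strict monotonicity of [G] traps [phi s] between [phi t - eps] and [phi t + eps], so [phi] is
    continuous. Then F s - F t is the positive slope of [G] at [phi s] times phi s - phi t, and
    dividing by that slope, continuous at [phi t], gives the derivative. *)
Lemma is_derive_implicit (G dG F phi : R -> R) (t d : R) :
  (forall s, is_derive G s (dG s)) -> (forall s, 0 < dG s) ->
  (forall s, G (phi s) = F s) -> is_derive F t d ->
  is_derive phi t (d / dG (phi t)).
Proof.
  intros hG hpos e hF.
  assert (hinc : forall x y, x < y -> G x < G y)
    by (intros x y hxy; apply (is_derive_increasing G dG); auto).
  assert (hphi : continuous phi t).
  { apply filterlim_locally. intros eps.
    assert (h1 := hinc (phi t - eps) (phi t)). assert (h2 := hinc (phi t) (phi t + eps)).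
    assert (he := cond_pos eps). rewrite e in h1, h2.
    destruct (continuous_pos_near (fun s => F s - G (phi t - eps)) t) as [e1 [he1 hn1]].
    { apply (continuous_minus F (fun _ => G (phi t - eps))).
      - apply (is_derive_continuous F t d hF).
      - apply continuous_const. }
    { lra. }
    destruct (continuous_pos_near (fun s => G (phi t + eps) - F s) t) as [e2 [he2 hn2]].
    { apply (continuous_minus (fun _ => G (phi t + eps)) F).
      - apply continuous_const.
      - apply (is_derive_continuous F t d hF). }
    { lra. }
    exists (mkposreal _ (Rmin_glb_lt _ _ _ he1 he2)). intros s hs.
    change (Rabs (s - t) < Rmin e1 e2) in hs.
    assert (hm1 := Rmin_l e1 e2). assert (hm2 := Rmin_r e1 e2).
    specialize (hn1 s ltac:(lra)). specialize (hn2 s ltac:(lra)).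
    change (Rabs (phi s - phi t) < eps). rewrite <- e in hn1, hn2.
    apply Rabs_def1.
    - destruct (Rtotal_order (phi s) (phi t + eps)) as [|[h|h]]; [lra|rewrite h in hn2; lra|].
      apply hinc in h; lra.
    - destruct (Rtotal_order (phi s) (phi t - eps)) as [h|[h|]]; [|rewrite h in hn1; lra|lra].
      apply hinc in h; lra. }
  assert (hslope : forall s, 0 < slope G (phi t) (dG (phi t)) s).
  { intros s. unfold slope. destruct (Req_dec_T s (phi t)) as [|hne]; [apply hpos|].
    destruct (Rdichotomy _ _ hne) as [h|h]; assert (h' := hinc _ _ h).
    - replace ((G s - G (phi t)) / (s - phi t)) with ((G (phi t) - G s) / (phi t - s))
        by (field; lra).
      apply Rdiv_lt_0_compat; lra.
    - apply Rdiv_lt_0_compat; lra. }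
  apply (is_derive_ext (fun s => plus (phi t)
    ((F s - F t) * / slope G (phi t) (dG (phi t)) (phi s)))).
  { intros s. rewrite <- !e, <- (slope_mult G (phi t) (dG (phi t))).
    specialize (hslope (phi s)). unfold plus; simpl. field. lra. }
  replace (d / dG (phi t)) with (plus 0 (d * / slope G (phi t) (dG (phi t)) (phi t)))
    by (rewrite slope_at; unfold plus; simpl; unfold Rdiv; ring).
  apply (is_derive_plus (V := R_NormedModule)); [apply (is_derive_const (V := R_NormedModule))|].
  apply (is_derive_mult_zero (fun s => F s - F t)
    (fun s => / slope G (phi t) (dG (phi t)) (phi s))).
  - replace d with (minus d 0) by (unfold minus, plus, opp; simpl; ring).
    apply (is_derive_minus F (fun _ => F t)); trivial.
    apply (is_derive_const (V := R_NormedModule)).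
  - ring.
  - apply (continuous_Rinv_comp (fun s => slope G (phi t) (dG (phi t)) (phi s)));
      [|specialize (hslope (phi t)); lra].
    apply (continuous_comp phi (slope G (phi t) (dG (phi t)))); trivial.
    apply continuous_slope, hG.
Qed.

(** Continuing along the tangent line at 0 turns one-sided derivatives at 0 into two-sided ones.
    Applied to the velocity of a convex solution, it gives a strictly increasing function on the
    whole line, unbounded below. *)
Definition extend (h h' : R -> R) (t : R) : R :=
  if Rle_dec 0 t then h t else h 0 + h' 0 * t.

Lemma extend_eq (h h' : R -> R) (t : R) : 0 <= t -> extend h h' t = h t.
Proof. intros ht. unfold extend. destruct (Rle_dec 0 t); [trivial | contradiction]. Qed.

Lemma extend_neg (h h' : R -> R) (t : R) : t < 0 -> extend h h' t = h 0 + h' 0 * t.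
Proof. intros ht. unfold extend. destruct (Rle_dec 0 t); [lra | trivial]. Qed.

Lemma is_derive_extend (h h' : R -> R) (t : R) : deriv_on_half_line h h' ->
  is_derive (extend h h') t (h' (Rmax 0 t)).
Proof.
  intros hd. destruct (Rlt_le_dec t 0) as [hneg|hpos].
  - rewrite Rmax_left by lra.
    apply (is_derive_ext_loc (fun s => h 0 + h' 0 * s)).
    + assert (hpos : 0 < - t) by lra. exists (mkposreal _ hpos). intros s hs.
      change (Rabs (s - t) < - t) in hs. apply Rabs_def2 in hs.
      rewrite extend_neg; lra.
    + auto_derive; trivial. ring.
  - rewrite Rmax_right by trivial. apply is_derive_Reals. intros eps heps.
    destruct (hd t hpos eps heps) as [alp [halp hlim]].
    simpl in hlim. unfold Rdist in hlim.
    assert (hal' : 0 < if Req_dec_T t 0 then alp else Rmin alp t).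
    { destruct (Req_dec_T t 0); [lra | apply Rmin_glb_lt; lra]. }
    exists (mkposreal _ hal'). intros u hu hlt. simpl in hlt.
    rewrite (extend_eq h h' t hpos).
    assert (hua : Rabs u < alp).
    { destruct (Req_dec_T t 0); trivial. assert (hm := Rmin_l alp t). lra. }
    destruct (Rlt_le_dec (t + u) 0) as [hn|hp].
    + destruct (Req_dec_T t 0) as [->|ht].
      * rewrite extend_neg by trivial.
        replace ((h 0 + h' 0 * (0 + u) - h 0) / u - h' 0) with 0 by (field; trivial).
        rewrite Rabs_R0; trivial.
      * assert (hm := Rmin_r alp t). assert (hr := Rle_abs (- u)). rewrite Rabs_Ropp in hr. lra.
    + rewrite extend_eq by trivial.
      specialize (hlim (t + u)). replace (t + u - t) with u in hlim by ring.
      apply hlim. repeat split; trivial. lra.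
Qed.

(** * Velocity as the independent variable *)

Section Comparison.

Variables (l a b : R).
Hypotheses (hl : 0 < l) (hb0 : 0 < b) (hb1 : b < 1).

Lemma convex_velocity_bounds (f f1 f2 f3 : R -> R) : bvp_solution l a b f f1 f2 f3 ->
  (forall t, half_line t -> 0 < f2 t) -> forall t, 0 <= t -> b <= f1 t < 1.
Proof.
  intros hs hc t ht.
  assert (hder : forall s, is_derive (extend f1 f2) s (f2 (Rmax 0 s)))
    by (intros s; apply is_derive_extend, hs).
  assert (hpos : forall s, 0 < f2 (Rmax 0 s)) by (intros s; apply hc, Rmax_l).
  assert (hinc : forall x y, 0 <= x < y -> f1 x < f1 y).
  { intros x y hxy. rewrite <- (extend_eq f1 f2 x), <- (extend_eq f1 f2 y) by lra.
    apply (is_derive_increasing _ (fun s => f2 (Rmax 0 s))); auto; lra. }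
  split.
  - rewrite <- (bvp_init' _ _ _ _ _ _ _ hs).
    destruct (Req_dec t 0) as [->|]; [lra|]. left; apply hinc; lra.
  (* A strictly later time turns the bound by the limit into a strict one. *)
  - apply Rlt_le_trans with (f1 (t + 1)); [apply hinc; lra|].
    destruct (Rle_dec (f1 (t + 1)) 1) as [|hgt]; trivial. exfalso.
    assert (hlim := bvp_infty _ _ _ _ _ _ _ hs). apply is_lim_spec in hlim.
    assert (he : 0 < f1 (t + 1) - 1) by lra.
    destruct (hlim (mkposreal _ he)) as [M hM]. simpl in hM.
    assert (h1 := Rmax_l M (t + 1)). assert (h2 := Rmax_r M (t + 1)).
    specialize (hM (Rmax M (t + 1) + 1) ltac:(lra)).
    specialize (hinc (t + 1) (Rmax M (t + 1) + 1) ltac:(lra)).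
    apply Rabs_def2 in hM. lra.
Qed.

(** The tangent continuation takes every value below [b] and the limit at infinity supplies those up
    to 1. All [y < 1] are needed, not only [y >= b], so that the change of time is defined on both
    sides of 0 and differentiable there. *)
Lemma velocity_inverse (g g1 g2 g3 : R -> R) : bvp_solution l a b g g1 g2 g3 ->
  (forall t, half_line t -> 0 < g2 t) -> forall y, y < 1 -> exists t, extend g1 g2 t = y.
Proof.
  intros hs hc y hy.
  assert (hder : forall s, is_derive (extend g1 g2) s (g2 (Rmax 0 s)))
    by (intros s; apply is_derive_extend, hs).
  assert (hg0 : 0 < g2 0) by (apply hc; unfold half_line; lra).
  assert (hlow : exists t, extend g1 g2 t <= y).
  { destruct (Rle_dec b y) as [h|h].
    - exists 0. rewrite extend_eq, (bvp_init' _ _ _ _ _ _ _ hs); lra.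
    - assert (hq : 0 < (b - y) / g2 0) by (apply Rdiv_lt_0_compat; lra).
      exists (- ((b - y) / g2 0)).
      rewrite extend_neg, (bvp_init' _ _ _ _ _ _ _ hs) by lra.
      right. field. lra. }
  assert (hhigh : exists t, y <= extend g1 g2 t).
  { assert (hlim := bvp_infty _ _ _ _ _ _ _ hs). apply is_lim_spec in hlim.
    assert (he : 0 < 1 - y) by lra.
    destruct (hlim (mkposreal _ he)) as [M hM]. simpl in hM.
    assert (h1 := Rmax_l M 0). assert (h2 := Rmax_r M 0).
    exists (Rmax M 0 + 1). specialize (hM (Rmax M 0 + 1) ltac:(lra)).
    apply Rabs_def2 in hM. rewrite extend_eq; lra. }
  destruct hlow as [x1 h1]. destruct hhigh as [x2 h2].
  destruct (IVT_gen (extend g1 g2) x1 x2 y) as [t [_ et]]; [| |exists t; exact et].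
  - intros x. apply continuity_pt_filterlim, (is_derive_continuous _ _ _ (hder x)).
  - rewrite Rmin_left, Rmax_right; lra.
Qed.

(* With [phi] determined by [g' (phi t) = f' t], the differences [f'' - g'' o phi] and
   [g o phi - f] solve a linear system with nonnegative coefficients. *)
Lemma convex_solution_compare (f f1 f2 f3 g g1 g2 g3 : R -> R) :
  bvp_solution l a b f f1 f2 f3 -> (forall t, half_line t -> 0 < f2 t) ->
  bvp_solution l a b g g1 g2 g3 -> (forall t, half_line t -> 0 < g2 t) ->
  g2 0 <= f2 0 -> forall t, 0 <= t -> g t = f t.
Proof.
  intros hf cf hg cg hle.
  assert (bf := convex_velocity_bounds f f1 f2 f3 hf cf).
  assert (inv := velocity_inverse g g1 g2 g3 hg cg).
  assert (dG1 : forall s, is_derive (extend g1 g2) s (g2 (Rmax 0 s)))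
    by (intros s; apply is_derive_extend, hg).
  assert (dF1 : forall s, is_derive (extend f1 f2) s (f2 (Rmax 0 s)))
    by (intros s; apply is_derive_extend, hf).
  assert (pG : forall s, 0 < g2 (Rmax 0 s)) by (intros s; apply cg, Rmax_l).
  assert (pF : forall s, 0 < f2 (Rmax 0 s)) by (intros s; apply cf, Rmax_l).
  assert (incG : forall x y, x < y -> extend g1 g2 x < extend g1 g2 y)
    by (intros x y hxy; apply (is_derive_increasing _ (fun s => g2 (Rmax 0 s))); auto).
  assert (F1lt : forall s, extend f1 f2 s < 1).
  { intros s. destruct (Rlt_le_dec s 0) as [h|h].
    - apply Rlt_trans with (extend f1 f2 0).
      + apply (is_derive_increasing _ (fun s => f2 (Rmax 0 s))); auto.
      + rewrite extend_eq by lra. apply bf; lra.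
    - rewrite extend_eq by trivial. apply bf; trivial. }
  (* The time at which [g] has the velocity that [f] has at time [s]; the preimage is chosen, but
     strict monotonicity makes it unique. *)
  set (phi := fun s => proj1_sig (constructive_indefinite_description _ (inv _ (F1lt s)))).
  assert (ephi : forall s, extend g1 g2 (phi s) = extend f1 f2 s)
    by (intros s; exact (proj2_sig (constructive_indefinite_description _ (inv _ (F1lt s))))).
  assert (g10 : extend g1 g2 0 = b)
    by (rewrite extend_eq by lra; apply (bvp_init' _ _ _ _ _ _ _ hg)).
  assert (f10 : extend f1 f2 0 = b)
    by (rewrite extend_eq by lra; apply (bvp_init' _ _ _ _ _ _ _ hf)).
  assert (phi_pos : forall s, 0 <= s -> 0 <= phi s).
  { intros s hs. destruct (Rle_dec 0 (phi s)) as [|h]; trivial. exfalso.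
    specialize (incG (phi s) 0 ltac:(lra)). rewrite ephi, g10, extend_eq in incG by trivial.
    destruct (bf s hs). lra. }
  assert (phi0 : phi 0 = 0).
  { destruct (Rtotal_order (phi 0) 0) as [h|[h|h]]; trivial; apply incG in h;
      rewrite ephi in h; lra. }
  assert (dphi : forall s, is_derive phi s (f2 (Rmax 0 s) / g2 (Rmax 0 (phi s)))).
  { intros s. apply (is_derive_implicit (extend g1 g2) (fun s => g2 (Rmax 0 s)) (extend f1 f2));
      auto. }
  assert (ephi' : forall s, 0 <= s -> g1 (phi s) = f1 s).
  { intros s hs. rewrite <- (extend_eq g1 g2), <- (extend_eq f1 f2) by auto. apply ephi. }
  set (E := fun s => extend g g1 (phi s) - extend f f1 s).
  set (D := fun s => extend f2 f3 s - extend g2 g3 (phi s)).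
  set (ca := fun s => extend f1 f2 s / extend g2 g3 (phi s)).
  set (cb := fun s => (1 + l) * extend f2 f3 s).
  set (cd := fun s => 2 * l * (1 - extend f1 f2 s) * ca s).
  assert (hE : forall s, 0 <= s -> is_derive E s (ca s * D s)).
  { intros s hs. specialize (phi_pos s hs). assert (pg := cg (phi s) phi_pos).
    replace (ca s * D s) with (minus (scal (f2 s / g2 (phi s)) (g1 (phi s))) (f1 s)).
    - apply (is_derive_minus (fun s => extend g g1 (phi s)) (extend f f1)).
      + apply (is_derive_comp (extend g g1) phi).
        * rewrite <- (Rmax_right 0 (phi s)) at 2 by trivial. apply is_derive_extend, hg.
        * specialize (dphi s). rewrite !Rmax_right in dphi by trivial. exact dphi.
      + rewrite <- (Rmax_right 0 s) at 2 by trivial. apply is_derive_extend, hf.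
    - unfold ca, D. rewrite !extend_eq, ephi' by trivial.
      unfold minus, plus, opp, scal; simpl; unfold mult; simpl. field. lra. }
  assert (hD : forall s, 0 <= s -> is_derive D s (cb s * E s + cd s * D s)).
  { intros s hs. specialize (phi_pos s hs). assert (pg := cg (phi s) phi_pos).
    replace (cb s * E s + cd s * D s) with (minus (f3 s) (scal (f2 s / g2 (phi s)) (g3 (phi s)))).
    - apply (is_derive_minus (extend f2 f3) (fun s => extend g2 g3 (phi s))).
      + rewrite <- (Rmax_right 0 s) at 2 by trivial. apply is_derive_extend, hf.
      + apply (is_derive_comp (extend g2 g3) phi).
        * rewrite <- (Rmax_right 0 (phi s)) at 2 by trivial. apply is_derive_extend, hg.
        * specialize (dphi s). rewrite !Rmax_right in dphi by trivial. exact dphi.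
    - unfold cb, cd, ca, D, E. rewrite !extend_eq by trivial.
      assert (of := bvp_ode _ _ _ _ _ _ _ hf s hs).
      assert (og := bvp_ode _ _ _ _ _ _ _ hg (phi s) phi_pos). rewrite ephi' in og by trivial.
      replace (f3 s) with (- ((1 + l) * f s * f2 s + 2 * l * (1 - f1 s) * f1 s)) by lra.
      replace (g3 (phi s)) with
        (- ((1 + l) * g (phi s) * g2 (phi s) + 2 * l * (1 - f1 s) * f1 s)) by lra.
      unfold minus, plus, opp, scal; simpl; unfold mult; simpl. field. lra. }
  assert (E0 : E 0 = 0).
  { unfold E. rewrite phi0, !extend_eq by lra.
    rewrite (bvp_init _ _ _ _ _ _ _ hf), (bvp_init _ _ _ _ _ _ _ hg). ring. }
  assert (D0 : D 0 = f2 0 - g2 0) by (unfold D; rewrite phi0, !extend_eq by lra; trivial).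
  assert (nca : forall s, 0 <= s -> 0 <= ca s).
  { intros s hs. unfold ca. rewrite !extend_eq by auto. assert (h := cg _ (phi_pos s hs)).
    destruct (bf s hs). apply Rdiv_le_0_compat; lra. }
  assert (ncb : forall s, 0 <= s -> 0 <= cb s).
  { intros s hs. unfold cb. rewrite extend_eq by trivial. assert (h := cf s hs).
    apply Rmult_le_pos; lra. }
  assert (ncd : forall s, 0 <= s -> 0 <= cd s).
  { intros s hs. unfold cd. specialize (nca s hs). rewrite extend_eq by trivial.
    destruct (bf s hs). apply Rmult_le_pos; [apply Rmult_le_pos|]; lra. }
  (* While D is nonnegative, E is nondecreasing from 0; then both terms of D' are nonnegative. At a
     first zero of D this would give D 0 <= 0, so a positive initial gap never closes. *)
  assert (grow : forall t, 0 <= t -> (forall s, 0 <= s <= t -> 0 <= D s) -> D 0 <= D t).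
  { intros t ht hDs.
    assert (hEs : forall s, 0 <= s <= t -> 0 <= E s).
    { intros s hs. rewrite <- E0. apply (is_derive_nondecreasing E (fun s => ca s * D s)); [lra| |].
      - intros r hr. apply hE; lra.
      - intros r hr. apply Rmult_le_pos; [apply nca | apply hDs]; lra. }
    apply (is_derive_nondecreasing D (fun s => cb s * E s + cd s * D s)); trivial.
    - intros r hr. apply hD; lra.
    - intros r hr. specialize (hEs r hr). specialize (hDs r hr).
      specialize (ncb r ltac:(lra)). specialize (ncd r ltac:(lra)).
      assert (0 <= cb r * E r) by (apply Rmult_le_pos; trivial).
      assert (0 <= cd r * D r) by (apply Rmult_le_pos; trivial). lra. }
  assert (eq0 : D 0 = 0).
  { destruct (Req_dec (D 0) 0) as [|hne]; trivial. exfalso.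
    assert (hD0 : 0 < D 0) by lra.
    assert (hDpos : forall t, 0 <= t -> 0 < D t).
    { intros t1 ht1. destruct (Rlt_le_dec 0 (D t1)) as [|h]; trivial. exfalso.
      destruct (first_zero D t1) as [t [ht [hz hb]]]; trivial.
      { intros s hs. apply (is_derive_continuous _ _ _ (hD s hs)). }
      specialize (grow t ltac:(lra)). rewrite hz in grow. assert (D 0 <= 0); [|lra].
      apply grow. intros s hs. destruct (Req_dec s t) as [->|]; [lra|].
      left; apply hb; lra. }
    (* Since g'' > 0, the gap gives f'' >= D 0 at all times; by time [T] the velocity would have
       risen from b to at least 1. *)
    set (T := (1 - b) / D 0).
    assert (hT : 0 < T) by (apply Rdiv_lt_0_compat; lra).
    assert (h : extend f1 f2 0 - D 0 * 0 <= extend f1 f2 T - D 0 * T).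
    { apply (is_derive_nondecreasing (fun s => extend f1 f2 s - D 0 * s)
        (fun s => f2 (Rmax 0 s) - D 0)); [lra| |].
      - intros s hs. apply (is_derive_minus (extend f1 f2) (fun s => D 0 * s)); auto.
        auto_derive; trivial. ring.
      - intros s hs. rewrite Rmax_right by lra.
        assert (h := grow s ltac:(lra) (fun r hr => Rlt_le _ _ (hDpos r (proj1 hr)))).
        unfold D at 2 in h. rewrite !extend_eq in h by (try apply phi_pos; lra).
        assert (hp := cg _ (phi_pos s (proj1 hs))). lra. }
    rewrite f10 in h. assert (hlt := F1lt T).
    replace (D 0 * T) with (1 - b) in h by (unfold T; field; lra). lra. }
  intros t ht.
  assert (cF : forall s, continuous (extend f1 f2) s)
    by (intros s; apply (is_derive_continuous _ _ _ (dF1 s))).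
  assert (cca : forall s, 0 <= s <= t -> continuous ca s).
  { intros s hs. apply (continuous_mult (extend f1 f2) (fun s => / extend g2 g3 (phi s))); trivial.
    apply (continuous_Rinv_comp (fun s => extend g2 g3 (phi s))).
    - apply (continuous_comp phi (extend g2 g3)).
      + apply (is_derive_continuous _ _ _ (dphi s)).
      + eapply is_derive_continuous, is_derive_extend, hg.
    - rewrite extend_eq by (apply phi_pos; lra).
      assert (h := cg _ (phi_pos s (proj1 hs))). lra. }
  assert (zero : forall s, 0 <= s <= t -> E s = 0 /\ D s = 0).
  { apply (linear_system_zero E D ca cb cd t 0); trivial; try lra.
    - intros s hs; apply hE; lra.
    - intros s hs; apply hD; lra.
    - intros s hs. apply (continuous_scal_r (1 + l) (extend f2 f3)).
      eapply is_derive_continuous, is_derive_extend, hf.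
    - intros s hs. apply (continuous_mult (fun s => 2 * l * (1 - extend f1 f2 s)) ca); auto.
      apply (continuous_scal_r (2 * l) (fun s => 1 - extend f1 f2 s)).
      apply (continuous_minus (fun _ => 1) (extend f1 f2)); trivial. apply continuous_const. }
  (* With D = 0 the accelerations agree at corresponding times, so phi' = 1 and phi is the identity;
     E = 0 then compares positions at equal times. *)
  assert (dphi1 : forall s, 0 <= s <= t -> is_derive phi s 1).
  { intros s hs. destruct (zero s hs) as [_ hz]. unfold D in hz.
    rewrite !extend_eq in hz by (try apply phi_pos; lra).
    assert (hp := cg _ (phi_pos s (proj1 hs))).
    specialize (dphi s). rewrite !Rmax_right in dphi by (try apply phi_pos; lra).
    replace (f2 s) with (g2 (phi s)) in dphi by lra.
    replace (g2 (phi s) / g2 (phi s)) with 1 in dphi by (field; lra). exact dphi. }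
  assert (h1 : phi 0 - 0 <= phi t - t).
  { apply (is_derive_nondecreasing (fun s => phi s - s) (fun s => 1 - 1)); trivial.
    - intros s hs. apply (is_derive_minus phi (fun s => s)); auto.
      apply (is_derive_id (K := R_AbsRing)).
    - intros; lra. }
  assert (h2 : 0 - phi 0 <= t - phi t).
  { apply (is_derive_nondecreasing (fun s => s - phi s) (fun s => 1 - 1)); trivial.
    - intros s hs. apply (is_derive_minus (fun s => s) phi); auto.
      apply (is_derive_id (K := R_AbsRing)).
    - intros; lra. }
  destruct (zero t ltac:(lra)) as [hz _]. unfold E in hz.
  replace (phi t) with t in hz by lra. rewrite !extend_eq in hz by trivial. lra.
Qed.

End Comparison.

Theorem theorem1 (lambda : R) (hlambda : 0 < lambda) (alpha beta : R)
    (hbeta0 : 0 < beta) (hbeta1 : beta < 1) :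
  exists f : R -> R,
    convex_solution lambda alpha beta f /\
    forall g : R -> R, convex_solution lambda alpha beta g ->
      forall t, half_line t -> g t = f t.
Proof.
  destruct (convex_solution_exists lambda alpha beta hlambda hbeta0 hbeta1)
    as [f [f1 [f2 [f3 [hf cf]]]]].
  exists f. split; [exists f1, f2, f3; split; trivial|].
  intros g [g1 [g2 [g3 [hg cg]]]] t ht.
  destruct (Rle_dec (g2 0) (f2 0)).
  - apply (convex_solution_compare lambda alpha beta hlambda hbeta0 hbeta1
      f f1 f2 f3 g g1 g2 g3); trivial.
  - symmetry. apply (convex_solution_compare lambda alpha beta hlambda hbeta0 hbeta1
      g g1 g2 g3 f f1 f2 f3); trivial. lra.
Qed.
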